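(* Let $G=(V,E)$ be a locally finite graph with symmetric positive edge weights $w_{xy}=w_{yx}>0$ and a measure $\mu:V\to(0,\infty)$. Let $\Omega\subset V$ be a bounded domain with $\Omega\neq\emptyset$ and $\partial\Omega\neq\emptyset$. Let $a>0$, $b\ge 0$, $p>4$, $r\ge 1$, let $k,m\in\mathbb{N}$ satisfy $1<\frac{2k}{m}\le p$, and let $Q,g:\Omega\to(0,\infty)$. Then for each $\lambda\in[0,+\infty)$ the problem $$-\Big(a+b\int_{\Omega\cup\partial\Omega}|\nabla u|^2d\mu\Big)\Delta u+\lambda g(x)u^{\frac{2k}{m}-1}=Q(x)|u|^{p-2}u\ln|u|^r\ \text{ in }\Omega,\qquad u=0\ \text{ on }\partial\Omega,$$ has a sign-changing solution $\tilde u\in\mathcal{M}$ such that $I(\tilde u)=\inf_{\mathcal{M}}I$ and a constant-sign solution $\bar u\in\mathcal{N}$ such that $I(\bar u)=\inf_{\mathcal{N}}I$, where $$\mathcal{M}=\{u\in\mathcal{H}^{1,2}_0(\Omega): u^{+}\neq0,\ u^-\neq 0,\ \langle I'(u),u^+\rangle=0,\ \langle I'(u),u^-\rangle=0\},$$ $$\mathcal{N}=\{u\in\mathcal{H}^{1,2}_0(\Omega): u\neq0,\ \langle I'(u),u\rangle=0\}.$$ Moreover, $\inf_{\mathcal{M}}I\ \ge\ 2\inf_{\mathcal{N}}I$.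
   Context: Write $y\sim x$ if $xy\in E$. Locally finite means each vertex has finitely many neighbours. The distance $d(x,y)$ is the minimal number of edges of a path connecting $x$ and $y$; $\Omega\subset V$ is a bounded domain if $d(x,y)$ is uniformly bounded over $x,y\in\Omega$ (hence $\Omega$ is finite). $\partial\Omega=\{y\in V\setminus\Omega:\exists x\in\Omega,\ xy\in E\}$; the interior $\Omega^\circ$ equals $\Omega$. Definitions: $\Delta u(x)=\frac1{\mu(x)}\sum_{y\sim x}w_{xy}(u(y)-u(x))$; $\nabla u\cdot\nabla v(x)=\frac1{2\mu(x)}\sum_{y\sim x}w_{xy}(u(y)-u(x))(v(y)-v(x))$; $|\nabla u|^2=\nabla u\cdot\nabla u$; $\int_A u\,d\mu=\sum_{x\in A}\mu(x)u(x)$. $\mathcal{H}^{1,2}_0(\Omega)$ is the (finite-dimensional) space of real functions $u$ on $\Omega$ with $u=0$ on $\partial\Omega$ (extended by $0$ to all of $V\setminus\Omega$), with norm $\|u\|=(\int_{\Omega\cup\partial\Omega}|\nabla u|^2d\mu)^{1/2}$. $u^+=\max\{u,0\}$, $u^-=\min\{u,0\}$. Conventions: for real $u$, $u^{\frac{2k}{m}}:=(u^{2k})^{1/m}=|u|^{2k/m}$ and $u^{\frac{2k}{m}-1}:=|u|^{\frac{2k}{m}-2}u$ (equal to $0$ at $u=0$); $|u|^p\ln|u|^r$ and $|u|^{p-2}u\ln|u|^r$ are $0$ at $u=0$. The energy functional $I:\mathcal{H}^{1,2}_0(\Omega)\to\mathbb{R}$ is $$I(u)=\tfrac a2\|u\|^2+\tfrac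 b4\|u\|^4+\tfrac{m}{2k}\int_\Omega\lambda g(x)u^{\frac{2k}{m}}d\mu+\tfrac r{p^2}\int_\Omega Q(x)|u|^pd\mu-\tfrac1p\int_\Omega Q(x)|u|^p\ln|u|^rd\mu,$$ which is $C^1$ with $$\langle I'(u),v\rangle=(a+b\|u\|^2)\int_{\Omega\cup\partial\Omega}\nabla u\cdot\nabla v\,d\mu+\lambda\int_\Omega g(x)u^{\frac{2k}{m}-1}v\,d\mu-\int_\Omega Q(x)|u|^{p-2}uv\ln|u|^rd\mu.$$ A solution is a function $u\in\mathcal{H}^{1,2}_0(\Omega)$ satisfying the equation at every $x\in\Omega$. It is sign-changing if $u^+\not\equiv0$ and $u^-\not\equiv0$; it is of constant sign if $u\ge0$ on $\Omega$ or $u\le0$ on $\Omega$.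
   Formalization: The existence of the sign-changing solution in M is stated only for Ω with at least two vertices; for a single-vertex Ω no function in the space changes sign, M is empty, and the claim as printed is false. *)

(* Defs.v *)
From HB Require Import structures.
From mathcomp Require Import all_boot all_order all_algebra.
From mathcomp Require Import all_classical all_reals all_analysis.

Set Implicit Arguments.
Unset Strict Implicit.
Unset Printing Implicit Defensive.

Import Order.TTheory GRing.Theory Num.Theory.

Local Open Scope classical_set_scope.
Local Open Scope ring_scope.

(* Only the values of [weight] on edges are constrained or ever used.  Loops
   are not excluded; they contribute 0 to every sum below. *)
Record weighted_graph (R : realType) := WeightedGraph {
  vertex :> choiceType ;
  adj : rel vertex ;
  weight : vertex -> vertex -> R ;
  mu : vertex -> R ;
  adj_sym : symmetric adj ;
  adj_locally_finite : forall x, finite_set [set y | adj x y] ;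
  weight_sym : forall x y, adj x y -> weight x y = weight y x ;
  weight_gt0 : forall x y, adj x y -> 0 < weight x y ;
  mu_gt0 : forall x, 0 < mu x }.

(* +oo when no path joins x to y *)
Definition dist (R : realType) (G : weighted_graph R) (x y : G) : \bar R :=
  ereal_inf [set ((size s)%:R : R)%:E | s in
    [set s : seq G | path (@adj R G) x s /\ last x s = y]].

Definition bounded_domain (R : realType) (G : weighted_graph R)
    (Omega : set G) : Prop :=
  exists D : R, forall x y, Omega x -> Omega y -> (dist x y <= D%:E)%E.

Definition boundary (R : realType) (G : weighted_graph R)
    (Omega : set G) : set G :=
  [set y | ~ Omega y /\ exists2 x, Omega x & adj x y].

Definition laplacian (R : realType) (G : weighted_graph R)
    (u : G -> R) (x : G) : R :=
  (mu x)^-1 * \sum_(y \in [set y | adj x y]) weight x y * (u y - u x).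

Definition grad_dot (R : realType) (G : weighted_graph R)
    (u v : G -> R) (x : G) : R :=
  (2 * mu x)^-1 *
    \sum_(y \in [set y | adj x y]) weight x y * (u y - u x) * (v y - v x).

(* [\sum_(x \in A)] is the finitely supported sum; it is only used on sets A
   that are finite when Omega is a bounded domain. *)
Definition gint (R : realType) (G : weighted_graph R)
    (A : set G) (u : G -> R) : R :=
  \sum_(x \in A) mu x * u x.

Definition H0 (R : realType) (G : weighted_graph R)
    (Omega : set G) : set (G -> R) :=
  [set u | forall x, ~ Omega x -> u x = 0].

Definition H0norm (R : realType) (G : weighted_graph R)
    (Omega : set G) (u : G -> R) : R :=
  Num.sqrt (gint (Omega `|` boundary Omega) (grad_dot u u)).

Definition pos_part (R : realType) (T : Type) (u : T -> R) : T -> R :=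
  fun x => Num.max (u x) 0.

(* nonpositive, unlike [u^\-] *)
Definition neg_part (R : realType) (T : Type) (u : T -> R) : T -> R :=
  fun x => Num.min (u x) 0.

(* t^(2k/m) = (t^(2k))^(1/m) *)
Definition even_pow (R : realType) (k m : nat) (t : R) : R :=
  (t ^+ (2 * k)) `^ (m%:R^-1).

(* t^(2k/m - 1) = |t|^(2k/m - 2) t; the factor t makes this 0 at t = 0 *)
Definition even_pow_pred (R : realType) (k m : nat) (t : R) : R :=
  `|t| `^ ((2 * k)%:R / m%:R - 2) * t.

(* |t|^p ln|t|^r; 0 at t = 0 since p > 0 gives 0 `^ p = 0 *)
Definition pow_log (R : realType) (p r t : R) : R :=
  `|t| `^ p * ln (`|t| `^ r).

(* |t|^(p-2) t ln|t|^r *)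
Definition pow_log_pred (R : realType) (p r t : R) : R :=
  `|t| `^ (p - 2) * t * ln (`|t| `^ r).

Definition energy (R : realType) (G : weighted_graph R) (Omega : set G)
    (a b lambda p r : R) (k m : nat) (g Q u : G -> R) : R :=
  a / 2 * H0norm Omega u ^+ 2 + b / 4 * H0norm Omega u ^+ 4
  + m%:R / (2 * k)%:R * gint Omega (fun x => lambda * g x * even_pow k m (u x))
  + r / p ^+ 2 * gint Omega (fun x => Q x * `|u x| `^ p)
  - p^-1 * gint Omega (fun x => Q x * pow_log p r (u x)).

(* <I'(u), v> for I = energy *)
Definition denergy (R : realType) (G : weighted_graph R) (Omega : set G)
    (a b lambda p r : R) (k m : nat) (g Q u v : G -> R) : R :=
  (a + b * H0norm Omega u ^+ 2)
    * gint (Omega `|` boundary Omega) (grad_dot u v)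
  + lambda * gint Omega (fun x => g x * even_pow_pred k m (u x) * v x)
  - gint Omega (fun x => Q x * pow_log_pred p r (u x) * v x).

Definition solution (R : realType) (G : weighted_graph R) (Omega : set G)
    (a b lambda p r : R) (k m : nat) (g Q u : G -> R) : Prop :=
  H0 Omega u /\
  forall x, Omega x ->
    - ((a + b * gint (Omega `|` boundary Omega) (grad_dot u u))
       * laplacian u x)
    + lambda * g x * even_pow_pred k m (u x)
    = Q x * pow_log_pred p r (u x).

Definition sign_changing (R : realType) (T : Type) (u : T -> R) : Prop :=
  pos_part u <> cst 0 /\ neg_part u <> cst 0.

Definition constant_sign (R : realType) (T : Type) (A : set T)
    (u : T -> R) : Prop :=
  (forall x, A x -> 0 <= u x) \/ (forall x, A x -> u x <= 0).

Definition nodal_nehari (R : realType) (G : weighted_graph R) (Omega : set G)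
    (a b lambda p r : R) (k m : nat) (g Q : G -> R) : set (G -> R) :=
  [set u | [/\ H0 Omega u, pos_part u <> cst 0, neg_part u <> cst 0,
     denergy Omega a b lambda p r k m g Q u (pos_part u) = 0 &
     denergy Omega a b lambda p r k m g Q u (neg_part u) = 0]].

Definition nehari (R : realType) (G : weighted_graph R) (Omega : set G)
    (a b lambda p r : R) (k m : nat) (g Q : G -> R) : set (G -> R) :=
  [set u | [/\ H0 Omega u, u <> cst 0 &
     denergy Omega a b lambda p r k m g Q u u = 0]].

(* +oo when S is empty *)
Definition inf_on (R : realType) (T : Type) (S : set T) (J : T -> R) : \bar R :=
  ereal_inf [set (J u)%:E | u in S].

(* Main.v *)
Require Import Defs.
From HB Require Import structures.
From mathcomp Require Import all_boot all_order all_algebra.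
From mathcomp Require Import all_classical all_reals all_analysis.
From mathcomp Require Import ring lra.

(* On functions supported in the finite set Omega the Dirichlet form has a Gram
   matrix with nonpositive off-diagonal entries, so <u+, u-> >= 0.  If u+ and u-
   are critical for I'(u), then for all s, t >= 0
     I(s u+ + t u-) + a/4 (|u+|^2 (s-1)^2 + |u-|^2 (t-1)^2) <= I(u),
   so I attains its maximum over the cone spanned by u+ and u- exactly at u;
   conversely a maximiser over the cone of any sign-changing w lies in M.  Since
   the logarithm wins at infinity, {I >= 0} is bounded, which gives both these
   maximisers and the minimisers of I over M and N.

   A minimiser u over M is critical without any degree theory.  Project
   w = u + eps v onto M, where v is supported at one vertex: the projection is
   y + eps sigma v with y = s u+ + t u- and sigma in {s, t}.  As
   I(y + eps sigma v) >= I(u) >= I(y) + c |y - u|^2, y tends to u as eps -> 0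
   and the mean value theorem yields <I'(u), v> >= 0.  The same argument with
   (u, 0) in place of (u+, u-) handles N, where |u| can replace u. *)

Set Implicit Arguments.
Unset Strict Implicit.
Unset Printing Implicit Defensive.

Import Order.TTheory GRing.Theory Num.Theory.
Import numFieldNormedType.Exports.

Local Open Scope classical_set_scope.
Local Open Scope ring_scope.

(** * Powers and logarithms *)

(** When 2k/m < 2 the functional is only C^1, and u -> u+ is not differentiable where u has zeros,
    so M is not treated as a smooth constraint: every argument compares energies. The decisive
    inequality lives at one vertex ([pot_scale_le]). Its multiplier (1 - s^p)/p is forced: no other
    one cancels ln|t|, whose sign is unknown. The Dirichlet terms must then be measured against (s^p
    - 1)/p, which dominates (s^4 - 1)/4 because p > 4. The b term, of degree 4, uses up this bound;
    the a term, of degree 2, leaves the gap (s^4 - 1)/4 - (s^2 - 1)/2 = (s^2 - 1)^2/4 >= (s -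
    1)^2/4, the origin of the quadratic surplus. Nontriviality survives limits because ln|t| <= 0 on
    |t| <= 1: a Nehari function, and each sign part of a nodal one, exceeds 1 in modulus somewhere,
    so the constraint sets are closed. *)

Section PowerLog.
Variable R : realType.
Implicit Types (s t x y alpha beta p q : R).

(** Young's inequality for the product of x and 1 with the conjugate exponents alpha and alpha /
    (alpha - 1), multiplied by alpha. *)
Lemma powR_bernoulli x alpha : 0 <= x -> 1 <= alpha ->
  alpha * (x - 1) <= x `^ alpha - 1.
Proof.
move=> x0; rewrite le_eqVlt => /predU1P[<-|a1]; first by rewrite powRr1// mul1r.
have a0 : 0 < alpha by lra.
have c0 : 0 < alpha / (alpha - 1) by rewrite divr_gt0//; lra.
have := @conjugate_powR _ x 1 _ _ x0 ler01 a0 c0.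
rewrite powR1 mulr1 div1r invf_div => /(_ _) H.
have E : alpha^-1 + (alpha - 1) / alpha = 1 by field; lra.
have := H E.
rewrite -(ler_pM2r a0) mulrDl -!mulrA mulVf ?gt_eqF// !mulr1; lra.
Qed.

(** Bernoulli for x^alpha with exponent beta / alpha. Used with the pairs (q, p) and (4, p), to
    bring lower-order terms under (s^p - 1)/p. *)
Lemma powR_sub1_div_le x alpha beta : 0 <= x -> 0 < alpha -> alpha <= beta ->
  (x `^ alpha - 1) / alpha <= (x `^ beta - 1) / beta.
Proof.
move=> x0 a0 ab; have b0 : 0 < beta by lra.
have := @powR_bernoulli (x `^ alpha) (beta / alpha) (powR_ge0 _ _).
rewrite ler_pdivlMr// mul1r => /(_ ab).
rewrite -powRrM (_ : alpha * (beta / alpha) = beta); last by field; rewrite gt_eqF.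
rewrite ler_pdivlMr// => h.
rewrite (_ : _ * beta = beta / alpha * (x `^ alpha - 1))//.
by field; rewrite gt_eqF.
Qed.

(** From ln(1/y) <= 1/y - 1, multiplied by -y. Used at y = s^p, where s = 0 is allowed. *)
Lemma mul_ln_ge y : 0 <= y -> y - 1 <= y * ln y.
Proof.
rewrite le_eqVlt => /predU1P[<-|y0]; first by rewrite mul0r; lra.
have yV0 : 0 < y^-1 by rewrite invr_gt0.
have /le_ln1Dx : -1 < y^-1 - 1 by lra.
rewrite addrC subrK lnV ?posrE// => h.
have : y * (- ln y) <= y * (y^-1 - 1) by rewrite ler_pM2l.
by rewrite mulrN mulrBr divff ?gt_eqF// mulr1; lra.
Qed.

Lemma norm_ln_le t : 0 < t <= 1 -> `|ln t| <= t^-1.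
Proof.
move=> /andP[t0 t1]; rewrite ler0_norm ?ln_le0//.
have h := mul_ln_ge (ltW t0).
by rewrite -(ler_pM2l t0) divff ?gt_eqF// mulrN; lra.
Qed.

Lemma norm_powRB2M t alpha : alpha != 0 ->
  `|t| `^ (alpha - 2) * t * t = `|t| `^ alpha.
Proof.
move=> a0; have [->|t0] := eqVneq t 0.
  by rewrite mulr0 normr0 powR0.
rewrite -mulrA -expr2 -[t ^+ 2]real_normK ?num_real// -powR_mulrn//.
by rewrite -powRD ?subrK// normr_eq0 t0 implybT.
Qed.

Lemma norm_powRB2 t alpha : alpha != 1 ->
  `| `|t| `^ (alpha - 2) * t| = `|t| `^ (alpha - 1).
Proof.
move=> a0; have [->|t0] := eqVneq t 0.
  by rewrite mulr0 normr0 powR0// subr_eq0.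
rewrite normrM norm_powR// normr_id -{2}[`|t|]powRr1//.
by rewrite -powRD ?normr_eq0 ?t0 ?implybT//; congr (_ `^ _); ring.
Qed.

(** The logarithm is traded for one power of |t|; since p > 4, enough powers remain for continuity
    and differentiability at 0. *)
Lemma norm_powR_ln_le t alpha : 1 < alpha -> `|t| <= 1 ->
  `| `|t| `^ alpha * ln `|t| | <= `|t| `^ (alpha - 1).
Proof.
move=> a0 t1; have [->|t0] := eqVneq t 0.
  by rewrite normr0 powR0 ?mul0r ?normr0 ?powR_ge0 ?gt_eqF//; lra.
have nt0 : 0 < `|t| by rewrite normr_gt0.
rewrite normrM norm_powR// normr_id powRB ?normr_eq0 ?t0 ?implybT//.
by rewrite powRr1// ler_pM2l ?powR_gt0// norm_ln_le// nt0.
Qed.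

Lemma cvg0_le_powR (f : R -> R) alpha : 0 < alpha ->
  (forall t, `|t| <= 1 -> `|f t| <= `|t| `^ alpha) -> f t @[t --> 0] --> 0.
Proof.
move=> a0 fle; apply/cvgr0Pnorm_lt => e e0.
have d0 : 0 < Num.min 1 (e `^ alpha^-1) by rewrite lt_min ltr01 powR_gt0.
apply: filterS (@nbhs0_lt R R _ d0) => t.
rewrite lt_min => /andP[t1 te]; apply: le_lt_trans (fle _ (ltW t1)) _.
rewrite (_ : e = (e `^ alpha^-1) `^ alpha); last first.
  by rewrite -powRrM mulVf ?gt_eqF// powRr1// ltW.
by apply: gt0_ltr_powR; rewrite ?nnegrE ?powR_ge0.
Qed.

Lemma continuous_powR_gt0 alpha x : 0 < x -> {for x, continuous (fun x => x `^ alpha)}.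
Proof.
move=> x0; apply/differentiable_continuous/derivable1_diffP.
by apply: derivable_powR; rewrite in_itv/= andbT.
Qed.

Lemma continuous_norm_powR_neq0 alpha t : t != 0 ->
  {for t, continuous (fun t => `|t| `^ alpha)}.
Proof.
move=> t0; apply: (@continuous_comp _ _ _ (fun t : R => `|t|) (fun x => x `^ alpha)).
  exact: norm_continuous.
by apply: continuous_powR_gt0; rewrite normr_gt0.
Qed.

Lemma continuous_ln_norm t : t != 0 -> {for t, continuous (fun t => ln `|t|)}.
Proof.
move=> t0; apply: (@continuous_comp _ _ _ (fun t : R => `|t|) (@ln R)).
  exact: norm_continuous.
by apply: continuous_ln; rewrite normr_gt0.
Qed.

Lemma continuous_norm_powRB2 alpha : 1 < alpha ->
  continuous (fun t => `|t| `^ (alpha - 2) * t).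
Proof.
move=> a1 t; have [->|t0] := eqVneq t 0; last first.
  by apply: cvgM; [exact: continuous_norm_powR_neq0|exact: cvg_id].
(* For alpha < 2 the factor |t|^(alpha - 2) is unbounded near 0; only its product with t, of modulus
   |t|^(alpha - 1), tends to 0. *)
rewrite /prop_for /continuous_at mulr0.
apply: (@cvg0_le_powR _ (alpha - 1)); first by lra.
by move=> t' _; rewrite norm_powRB2// gt_eqF.
Qed.

Lemma continuous_norm_powRB2_ln alpha : 2 < alpha ->
  continuous (fun t => `|t| `^ (alpha - 2) * t * ln `|t|).
Proof.
move=> a1 t; have [->|t0] := eqVneq t 0; last first.
  apply: cvgM; last exact: continuous_ln_norm.
  by apply: cvgM; [exact: continuous_norm_powR_neq0|exact: cvg_id].
rewrite /prop_for /continuous_at mulr0 mul0r.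
apply: (@cvg0_le_powR _ (alpha - 1 - 1)); first by lra.
move=> t' t1; rewrite normrM norm_powRB2; last by lra.
apply: le_trans (norm_powR_ln_le _ t1); last by lra.
by rewrite normrM (norm_powR _ (normr_ge0 _)) normr_id.
Qed.

(* At 0 the bound makes the difference quotient tend to 0; away from 0 parity
   reduces to the positive half-line. *)
Lemma is_derive1_even (f df : R -> R) alpha : 0 < alpha ->
  (forall t, f (- t) = f t) -> (forall t, df (- t) = - df t) ->
  (forall t, 0 < t -> is_derive t 1 f (df t)) -> f 0 = 0 ->
  (forall t, `|t| <= 1 -> `|f t| <= `|t| `^ (1 + alpha)) ->
  forall t, is_derive t 1 f (df t).
Proof.
move=> a0 fN dfN fpos f0 fle t.
have [t0|t0|->] := ltgtP t 0; last 1 first.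
- have -> : df 0 = 0 by have := dfN 0; rewrite oppr0; lra.
  have H : h^-1 *: (f (h *: 1 + 0) - f 0) @[h --> 0^'] --> 0.
    have -> : (fun h => h^-1 *: (f (h *: 1 + 0) - f 0)) = (fun h => h^-1 * f h).
      by apply/funext => h; rewrite f0 subr0 addr0 [_%:A]mulr1.
    apply: cvg_within_filter; apply: (@cvg0_le_powR _ alpha) => // h h1.
    have [->|h0] := eqVneq h 0; first by rewrite invr0 mul0r !normr0 powR_ge0.
    rewrite normrM normfV ler_pdivrMl ?normr_gt0//.
    apply: le_trans (fle _ h1) _.
    by rewrite powRD ?powRr1// normr_eq0 h0 implybT.
  apply: DeriveDef; first by apply/cvg_ex; exists 0.
  exact: cvg_lim H.
- have nt : 0 < - t by lra.
  have := fpos _ nt => H.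
  have -> : f = f \o -%R by apply/funext => x /=; rewrite fN.
  apply: (is_derive_eq (is_derive1_comp H (is_deriveNid t 1))).
  by rewrite dfN; ring.
- exact: fpos.
Qed.

Lemma is_derive1_norm_powR alpha t : 1 < alpha ->
  is_derive t 1 (fun t => `|t| `^ alpha) (alpha * (`|t| `^ (alpha - 2) * t)).
Proof.
move=> a1.
apply: (@is_derive1_even (fun t => `|t| `^ alpha)
  (fun t => alpha * (`|t| `^ (alpha - 2) * t)) (alpha - 1)); first by lra.
- by move=> x; rewrite normrN.
- by move=> x; rewrite normrN; ring.
- move=> x x0; apply: (@near_eq_is_derive _ _ _ (fun x => x `^ alpha)).
    near=> y; rewrite gtr0_norm//; near: y; exact: lt_nbhsr.
  apply: is_derive_eq; first exact: is_derive1_powR.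
  rewrite (_ : alpha - 1 = alpha - 2 + 1); last by ring.
  by rewrite gtr0_norm// powRD ?(gt_eqF x0) ?implybT// powRr1// ltW.
- by rewrite normr0 powR0// gt_eqF//; lra.
- by move=> x x1; rewrite norm_powR// normr_id addrC subrK.
Unshelve. all: by end_near. Qed.

Lemma is_derive1_norm_powR_ln alpha t : 2 < alpha ->
  is_derive t 1 (fun t => `|t| `^ alpha * ln `|t|)
    (alpha * (`|t| `^ (alpha - 2) * t * ln `|t|) + `|t| `^ (alpha - 2) * t).
Proof.
move=> a1.
apply: (@is_derive1_even (fun t => `|t| `^ alpha * ln `|t|)
  (fun t => alpha * (`|t| `^ (alpha - 2) * t * ln `|t|) + `|t| `^ (alpha - 2) * t)
  (alpha - 2)); first by lra.
- by move=> x; rewrite normrN.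
- by move=> x; rewrite normrN; ring.
- move=> x x0; apply: (@near_eq_is_derive _ _ _ ((fun x => x `^ alpha) * (@ln R))).
    near=> y; rewrite gtr0_norm//; near: y; exact: lt_nbhsr.
  have H1 := is_derive1_powR alpha x0; have H2 := is_derive1_ln x0.
  apply: is_derive_eq.
  rewrite /GRing.scale/= gtr0_norm//.
  rewrite (_ : alpha - 1 = alpha - 2 + 1); last by ring.
  rewrite (_ : x `^ alpha = x `^ (alpha - 2) * x * x); last first.
    have a0 : alpha != 0 by rewrite gt_eqF//; lra.
    by have := norm_powRB2M x a0; rewrite gtr0_norm.
  rewrite (@powRD _ x (alpha - 2) 1) ?(gt_eqF x0) ?implybT// powRr1 ?ltW//.
  by field; rewrite gt_eqF.
- by rewrite normr0 powR0 ?mul0r// gt_eqF//; lra.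
- move=> x x1; apply: le_trans (norm_powR_ln_le _ x1) _; first by lra.
  by rewrite (_ : alpha - 1 = 1 + (alpha - 2)); [|ring].
Unshelve. all: by end_near. Qed.

End PowerLog.

(** * Discrete Dirichlet forms and the potential *)

Section DerivativeRules.
Variable R : realType.
Implicit Types (f g : R -> R) (t c df dg : R).

Lemma is_derive1Z f t c df : is_derive t 1 f df ->
  is_derive t 1 (fun s => c * f s) (c * df).
Proof. exact: is_deriveZ. Qed.

Lemma is_derive1D f g t df dg : is_derive t 1 f df -> is_derive t 1 g dg ->
  is_derive t 1 (fun s => f s + g s) (df + dg).
Proof. exact: is_deriveD. Qed.

Lemma is_derive1M f g t df dg : is_derive t 1 f df -> is_derive t 1 g dg ->
  is_derive t 1 (fun s => f s * g s) (f t * dg + g t * df).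
Proof. exact: is_deriveM. Qed.

Lemma is_derive1_sum (I : Type) (r : seq I) (f : I -> R -> R)
    (df : I -> R) (t : R) :
  (forall i, is_derive t 1 (f i) (df i)) ->
  is_derive t 1 (fun s => \sum_(i <- r) f i s) (\sum_(i <- r) df i).
Proof.
move=> dfi; elim: r => [|i r IH].
  rewrite big_nil (_ : (fun _ => _) = cst 0); first exact: is_derive_cst.
  by apply/funext => s; rewrite big_nil.
rewrite big_cons (_ : (fun _ => _) = f i + (fun s => \sum_(j <- r) f j s)).
  exact: is_deriveD.
by apply/funext => s; rewrite big_cons.
Qed.

End DerivativeRules.

Lemma cvg_sum_seq (R : realType) (T I : Type) (F : set_system T) (FF : Filter F)
    (r : seq I) (f : I -> T -> R) (l : I -> R) :
  (forall i, f i t @[t --> F] --> l i) ->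
  \sum_(i <- r) f i t @[t --> F] --> \sum_(i <- r) l i.
Proof. by move=> fl; apply: cvg_big => //; exact: add_continuous. Qed.

Lemma ler_norm_sum_fin (R : realType) (X : finType) (u : X -> R) (x : X) :
  `|u x| <= \sum_y `|u y|.
Proof. by rewrite (bigD1 x)//= lerDl sumr_ge0. Qed.

Section BilinearForm.
Variables (R : realType) (X : finType) (e : X -> X -> R).
Implicit Types u v w : X -> R.

Definition bform u v := \sum_x \sum_y e x y * u x * v y.

Definition comb (s t : R) (w1 w2 : X -> R) : X -> R :=
  fun x => s * w1 x + t * w2 x.

Lemma combC s t w1 w2 : comb s t w1 w2 = comb t s w2 w1.
Proof. by apply/funext => x; rewrite /comb addrC. Qed.

Hypothesis esym : forall x y, e x y = e y x.
Hypothesis eoff : forall x y, x != y -> e x y <= 0.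
Hypothesis epos : forall u, (exists x, u x != 0) -> 0 < bform u u.

Lemma bformC u v : bform u v = bform v u.
Proof.
rewrite /bform exchange_big; apply: eq_bigr => x _; apply: eq_bigr => y _.
by rewrite esym mulrAC.
Qed.

Lemma bform_combl s t w1 w2 v :
  bform (comb s t w1 w2) v = s * bform w1 v + t * bform w2 v.
Proof.
rewrite /bform !mulr_sumr -big_split; apply: eq_bigr => x _ /=.
rewrite !mulr_sumr -big_split; apply: eq_bigr => y _ /=.
by rewrite /comb; ring.
Qed.

Lemma bform_comb s t w1 w2 : bform (comb s t w1 w2) (comb s t w1 w2) =
  s ^+ 2 * bform w1 w1 + t ^+ 2 * bform w2 w2 + 2 * s * t * bform w1 w2.
Proof.
by rewrite bform_combl 2!(bformC _ (comb _ _ _ _)) !bform_combl (bformC w2 w1); ring.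
Qed.

Lemma bform0r u : bform u (fun=> 0) = 0.
Proof. by rewrite /bform big1// => x _; rewrite big1// => y _; rewrite mulr0. Qed.

Lemma bform_ge0 u : 0 <= bform u u.
Proof.
have [/epos/ltW//|u0] := pselect (exists x, u x != 0).
rewrite (_ : u = fun=> 0) ?bform0r//; apply/funext => x.
by apply/eqP/negP => /negP ux; apply: u0; exists x.
Qed.

(** Diagonal terms vanish by disjointness of supports; off the diagonal a nonpositive entry meets a
    nonpositive product. *)
Lemma bform_opp_sign_ge0 u v : (forall x, 0 <= u x) -> (forall x, v x <= 0) ->
  (forall x, u x * v x = 0) -> 0 <= bform u v.
Proof.
move=> u0 v0 uv; apply: sumr_ge0 => x _; apply: sumr_ge0 => y _.
have [<-|xy] := eqVneq x y; first by rewrite -mulrA uv mulr0.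
by rewrite -mulrA; apply: mulr_le0; [exact: eoff|exact: mulr_ge0_le0].
Qed.

(** Diagonal terms do not see signs, and the nonpositive off-diagonal entries favour the larger
    product |u x| |u y|. *)
Lemma bform_norm u : bform (fun x => `|u x|) (fun x => `|u x|) <= bform u u.
Proof.
apply: ler_sum => x _; apply: ler_sum => y _; rewrite -!mulrA -normrM.
have [<-|xy] := eqVneq x y; first by rewrite -expr2 ger0_norm ?sqr_ge0.
by rewrite ler_wnM2l ?eoff// ler_norm.
Qed.

Lemma bform_le u c : (forall x, `|u x| <= c) ->
  bform u u <= (\sum_x \sum_y `|e x y|) * c ^+ 2.
Proof.
move=> uc; rewrite mulr_suml; apply: ler_sum => x _.
rewrite mulr_suml; apply: ler_sum => y _.
apply: le_trans (ler_norm _) _.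
by rewrite -mulrA normrM ler_wpM2l// normrM expr2 ler_pM.
Qed.

Lemma cvg_bform (T : Type) (F : set_system T) (FF : Filter F)
    (u v : T -> X -> R) (u0 v0 : X -> R) :
  (forall x, u t x @[t --> F] --> u0 x) ->
  (forall x, v t x @[t --> F] --> v0 x) ->
  bform (u t) (v t) @[t --> F] --> bform u0 v0.
Proof.
move=> cu cv; apply: cvg_sum_seq => x; apply: cvg_sum_seq => y.
by apply: cvgM => //; apply: cvgM => //; exact: cvg_cst.
Qed.

End BilinearForm.

(** * The energy carried by one vertex *)

Section Potential.
Variables (R : realType) (p q : R).
Hypotheses (hp : 4 < p) (q1 : 1 < q) (qp : q <= p).
Implicit Types (alpha beta s t : R).

(** To be used with q = 2k/m, alpha = lambda g mu and beta = r Q mu: as ln(|t|^r) = r ln|t|, the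
    exponent r is absorbed in beta. The term |t|^p / p^2 cancels what differentiating the logarithm
    produces, so that [dpot] has a single term in beta. *)
Definition pot alpha beta t := alpha / q * `|t| `^ q
  + beta * (`|t| `^ p / p ^+ 2 - `|t| `^ p * ln `|t| / p).

Definition dpot alpha beta t := alpha * (`|t| `^ (q - 2) * t)
  - beta * (`|t| `^ (p - 2) * t * ln `|t|).

Let p_gt0 : 0 < p. Proof. by move: hp; lra. Qed.
Let q_gt0 : 0 < q. Proof. by move: q1; lra. Qed.
Let p_neq0 : p != 0. Proof. by rewrite gt_eqF. Qed.
Let q_neq0 : q != 0. Proof. by rewrite gt_eqF. Qed.

Lemma pot0 alpha beta : pot alpha beta 0 = 0.
Proof. by rewrite /pot normr0 !powR0//; ring. Qed.

Lemma dpotM alpha beta t :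
  dpot alpha beta t * t = alpha * `|t| `^ q - beta * (`|t| `^ p * ln `|t|).
Proof.
rewrite /dpot -(norm_powRB2M t q_neq0) -(norm_powRB2M t p_neq0).
ring.
Qed.

Lemma is_derive1_pot alpha beta t :
  is_derive t 1 (pot alpha beta) (dpot alpha beta t).
Proof.
have H1 := is_derive1_norm_powR t q1.
have p1 : 1 < p by move: hp; lra.
have p2 : 2 < p by move: hp; lra.
have H2 := is_derive1_norm_powR t p1.
have H3 := is_derive1_norm_powR_ln t p2.
rewrite (_ : pot alpha beta = fun s => alpha / q * `|s| `^ q
    + (beta / p ^+ 2 * `|s| `^ p + - (beta / p) * (`|s| `^ p * ln `|s|))).
  apply: (is_derive_eq (is_derive1D (is_derive1Z _ H1)
    (is_derive1D (is_derive1Z _ H2) (is_derive1Z _ H3)))).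
  by rewrite /dpot; field; rewrite p_neq0 q_neq0.
by apply/funext => s; rewrite /pot; field; rewrite p_neq0 q_neq0.
Qed.

Lemma continuous_pot alpha beta : continuous (pot alpha beta).
Proof.
move=> t; apply/differentiable_continuous/derivable1_diffP.
by have [] := is_derive1_pot alpha beta t.
Qed.

Lemma continuous_dpot alpha beta : continuous (dpot alpha beta).
Proof.
move=> t; apply: cvgB; apply: cvgM; [exact: cvg_cst| |exact: cvg_cst|].
  exact: continuous_norm_powRB2.
by apply: continuous_norm_powRB2_ln; move: hp; lra.
Qed.

Lemma powR_ln_scale s t : 0 <= s ->
  `|s * t| `^ p * ln `|s * t| = s `^ p * `|t| `^ p * (ln s + ln `|t|).
Proof.
rewrite le_eqVlt => /predU1P[<-|s0]; first by rewrite mul0r normr0 powR0// !mul0r.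
have [->|t0] := eqVneq t 0; first by rewrite mulr0 normr0 powR0// mulr0 !mul0r.
rewrite normrM (gtr0_norm s0) powRM ?(ltW s0)// lnM ?posrE ?normr_gt0//.
Qed.

(** Once the terms in ln|t| have cancelled, the difference is a combination, with nonnegative
    coefficients, of (s^p - 1)/p - (s^q - 1)/q, where q <= p enters, and of S ln S - (S - 1) with S
    = s^p. *)
Lemma pot_scale_le alpha beta s t : 0 <= alpha -> 0 <= beta -> 0 <= s ->
  pot alpha beta (s * t) + (1 - s `^ p) / p * (dpot alpha beta t * t)
    <= pot alpha beta t.
Proof.
move=> a0 b0 s0; rewrite dpotM /pot powR_ln_scale// normrM (ger0_norm s0) !powRM//.
have := powR_sub1_div_le s0 q_gt0 qp.
have := mul_ln_ge (powR_ge0 s p); rewrite ln_powR.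
move: (powR_ge0 `|t| q) (powR_ge0 `|t| p).
move: (s `^ p) (s `^ q) (`|t| `^ q) (`|t| `^ p) (ln s) (ln `|t|) => S S' T P l L.
move=> T0 P0 h1 h2; rewrite -subr_ge0.
have -> : alpha / q * T + beta * (P / p ^+ 2 - P * L / p) -
  (alpha / q * (S' * T) + beta * (S * P / p ^+ 2 - S * P * (l + L) / p) +
   (1 - S) / p * (alpha * T - beta * (P * L))) =
  alpha * T * ((S - 1) / p - (S' - 1) / q)
  + beta * P * ((S * (p * l) - (S - 1)) / p ^+ 2).
  by field; rewrite p_neq0 q_neq0.
by rewrite addr_ge0 ?mulr_ge0 ?subr_ge0 ?invr_ge0 ?exprn_ge0 ?(ltW p_gt0)//.
Qed.

(** The term -|t|^p ln|t| is positive only for |t| < 1, where it is at most 1 <= c^p. *)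
Lemma pot_le alpha beta t c : 0 <= alpha -> 0 <= beta -> 1 <= c -> `|t| <= c ->
  pot alpha beta t <= (alpha / q + beta / p ^+ 2 + beta / p) * c `^ p.
Proof.
move=> a0 b0 c1 tc; have c0 : 0 <= c by lra.
have tp : `|t| `^ p <= c `^ p.
  by apply: ge0_ler_powR; rewrite ?nnegrE// ltW.
have tq : `|t| `^ q <= c `^ p.
  apply: le_trans (ler_powR c1 qp).
  by apply: ge0_ler_powR; rewrite ?nnegrE// ltW.
have cp1 : 1 <= c `^ p by rewrite -[leLHS](powRr0 c) ler_powR// ltW.
have lp : - (`|t| `^ p * ln `|t|) <= c `^ p.
  apply: le_trans cp1; have [t1|t1] := leP `|t| 1; last first.
    have : 0 <= `|t| `^ p * ln `|t| by rewrite mulr_ge0 ?powR_ge0// ln_ge0// ltW.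
    lra.
  apply: le_trans (ler_norm _) _; rewrite normrN.
  apply: le_trans (norm_powR_ln_le _ t1) _; first by move: hp; lra.
  apply: (@le_trans _ _ (1 `^ (p - 1))); last by rewrite powR1.
  by apply: ge0_ler_powR; rewrite ?nnegrE//; move: hp; lra.
rewrite /pot mulrBr !mulrDl -addrA lerD//.
  by rewrite ler_wpM2l// divr_ge0// ltW.
apply: lerD.
  by rewrite mulrA mulrAC ler_wpM2l// divr_ge0// exprn_ge0// ltW.
rewrite (_ : - _ = beta / p * (- (`|t| `^ p * ln `|t|))); last by ring.
by rewrite ler_wpM2l// divr_ge0// ltW.
Qed.

(** For |t| <= 1 the logarithm is nonpositive, so no term is negative. This yields the gain of
    energy along small multiples in [En_comb_gt]; its analogue [dpotM_ge0] yields the threshold 1 in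
    [exists_gt1]. *)
Lemma pot_ge0 alpha beta t : 0 <= alpha -> 0 <= beta -> `|t| <= 1 ->
  0 <= pot alpha beta t.
Proof.
move=> a0 b0 t1; rewrite addr_ge0 ?mulr_ge0 ?invr_ge0 ?powR_ge0 ?(ltW q_gt0)//.
rewrite subr_ge0 (@le_trans _ _ 0)//.
  by rewrite pmulr_lle0 ?invr_gt0// mulr_ge0_le0 ?powR_ge0// ln_le0.
by rewrite divr_ge0 ?powR_ge0 ?exprn_ge0// ltW.
Qed.

Lemma dpotM_ge0 alpha beta t : 0 <= alpha -> 0 <= beta -> `|t| <= 1 ->
  0 <= dpot alpha beta t * t.
Proof.
move=> a0 b0 t1; rewrite dpotM subr_ge0 (@le_trans _ _ 0)//.
  by rewrite mulr_ge0_le0// mulr_ge0_le0 ?powR_ge0// ln_le0.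
by rewrite mulr_ge0 ?powR_ge0.
Qed.

End Potential.

(** * The variational argument *)

Section Energy.
Variables (R : realType) (X : finType) (e : X -> X -> R).
Variables (a b p q : R) (A B : X -> R).
Hypothesis esym : forall x y, e x y = e y x.
Hypothesis eoff : forall x y, x != y -> e x y <= 0.
Hypothesis epos : forall u : X -> R, (exists x, u x != 0) -> 0 < bform e u u.
Hypotheses (a_gt0 : 0 < a) (b_ge0 : 0 <= b).
Hypotheses (p_gt4 : 4 < p) (q_gt1 : 1 < q) (q_le_p : q <= p).
Hypotheses (A_ge0 : forall x, 0 <= A x) (B_gt0 : forall x, 0 < B x).
Implicit Types u v w : X -> R.

Local Notation E := (bform e).

Definition En u := a / 2 * E u u + b / 4 * E u u ^+ 2
  + \sum_x pot p q (A x) (B x) (u x).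

Definition dEn u v := (a + b * E u u) * E u v
  + \sum_x dpot p q (A x) (B x) (u x) * v x.

Let p_gt0 : 0 < p. Proof. by move: p_gt4; lra. Qed.
Let q_gt0 : 0 < q. Proof. by move: q_gt1; lra. Qed.
Let B_ge0 x : 0 <= B x. Proof. exact: ltW. Qed.

Lemma cvg_En (T : Type) (F : set_system T) (FF : Filter F)
    (u : T -> X -> R) (u0 : X -> R) :
  (forall x, u t x @[t --> F] --> u0 x) -> En (u t) @[t --> F] --> En u0.
Proof.
move=> cu; have cE := cvg_bform (e := e) FF cu cu.
apply: cvgD; first apply: cvgD.
- by apply: cvgM => //; exact: cvg_cst.
- by apply: cvgM; [exact: cvg_cst|apply: cvgM].
- apply: cvg_sum_seq => x.
  apply: (cvg_comp (fun t => u t x) (pot p q (A x) (B x)) (cu x)).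
  exact: continuous_pot.
Qed.

Lemma cvg_dEn (T : Type) (F : set_system T) (FF : Filter F)
    (u v : T -> X -> R) (u0 v0 : X -> R) :
  (forall x, u t x @[t --> F] --> u0 x) ->
  (forall x, v t x @[t --> F] --> v0 x) ->
  dEn (u t) (v t) @[t --> F] --> dEn u0 v0.
Proof.
move=> cu cv; have cE := cvg_bform (e := e) FF cu cu; have cE' := cvg_bform (e := e) FF cu cv.
apply: cvgD.
  apply: cvgM => //; apply: cvgD; first exact: cvg_cst.
  by apply: cvgM => //; exact: cvg_cst.
apply: cvg_sum_seq => x; apply: cvgM => //.
apply: (cvg_comp (fun t => u t x) (dpot p q (A x) (B x)) (cu x)).
exact: continuous_dpot.
Qed.

Lemma is_derive1_En u v (t : R) :
  is_derive t 1 (fun s => En (comb 1 s u v)) (dEn (comb 1 t u v) v).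
Proof.
have H1 : is_derive t 1 (fun s : R => s) 1 := is_derive_id t (1 : R).
have dE : is_derive t 1 (fun s => E (comb 1 s u v) (comb 1 s u v))
    (2 * E (comb 1 t u v) v).
  rewrite (_ : (fun _ => _) = fun s =>
      E u u + (E v v * (s * s) + 2 * E u v * s)); last first.
    by apply/funext => s; rewrite bform_comb//; ring.
  apply: (is_derive_eq (is_derive1D (is_derive_cst (E u u) t (1 : R))
    (is_derive1D (is_derive1Z _ (is_derive1M H1 H1)) (is_derive1Z _ H1)))).
  by rewrite bform_combl; ring.
have dS : is_derive t 1
    (fun s => \sum_x pot p q (A x) (B x) (comb 1 s u v x))
    (\sum_x dpot p q (A x) (B x) (comb 1 t u v x) * v x).
  apply: is_derive1_sum => x.
  have Hp := is_derive1_pot p_gt4 q_gt1 (A x) (B x) (comb 1 t u v x).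
  have Hc : is_derive t 1 (fun s => comb 1 s u v x) (v x).
    rewrite (_ : (fun _ => _) = fun s => u x + v x * s); last first.
      by apply/funext => s; rewrite /comb; ring.
    apply: (is_derive_eq (is_derive1D (is_derive_cst (u x) t (1 : R))
      (is_derive1Z (v x) H1))).
    by ring.
  exact: (@is_derive1_comp _ (pot p q (A x) (B x)) (fun s => comb 1 s u v x)
    _ _ _ Hp Hc).
rewrite (_ : (fun s => En _) = fun s =>
  a / 2 * E (comb 1 s u v) (comb 1 s u v)
  + b / 4 * (E (comb 1 s u v) (comb 1 s u v) * E (comb 1 s u v) (comb 1 s u v))
  + \sum_x pot p q (A x) (B x) (comb 1 s u v x)); last first.
  by apply/funext => s; rewrite /En expr2.
apply: (is_derive_eq (is_derive1D (is_derive1D (is_derive1Z _ dE)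
  (is_derive1Z _ (is_derive1M dE dE))) dS)).
by rewrite /dEn; field.
Qed.

Lemma dEn_linear u s t (w1 w2 : X -> R) :
  dEn u (comb s t w1 w2) = s * dEn u w1 + t * dEn u w2.
Proof.
rewrite /dEn bformC// bform_combl 2!(bformC esym _ u).
rewrite (_ : \sum_x dpot p q (A x) (B x) (u x) * comb s t w1 w2 x =
  s * (\sum_x dpot p q (A x) (B x) (u x) * w1 x)
  + t * (\sum_x dpot p q (A x) (B x) (u x) * w2 x)); first by ring.
rewrite !mulr_sumr -big_split; apply: eq_bigr => x _ /=.
by rewrite /comb; ring.
Qed.

(** * Energy along the cone spanned by two functions with disjoint supports *)

Section Decomposition.
Variables (u w1 w2 : X -> R).
Hypotheses (disj : forall x, w1 x * w2 x = 0) (E12 : 0 <= E w1 w2).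
Hypothesis uE : u = comb 1 1 w1 w2.

(** The hypotheses cover (u+, u-), its swap and (u, 0). At each vertex w1 or w2 vanishes, so the
    potential part is [pot_scale_le] vertex by vertex; what is left is a polynomial inequality in s,
    t and the three values of the form. *)
Lemma En_comb_le s t : 0 <= s -> 0 <= t ->
  En (comb s t w1 w2) + a / 4 * (E w1 w1 * (s - 1) ^+ 2 + E w2 w2 * (t - 1) ^+ 2)
  + (1 - s `^ p) / p * dEn u w1 + (1 - t `^ p) / p * dEn u w2 <= En u.
Proof.
move=> s0 t0.
have hpot : \sum_x pot p q (A x) (B x) (comb s t w1 w2 x)
   + (1 - s `^ p) / p * (\sum_x dpot p q (A x) (B x) (u x) * w1 x)
   + (1 - t `^ p) / p * (\sum_x dpot p q (A x) (B x) (u x) * w2 x)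
   <= \sum_x pot p q (A x) (B x) (u x).
  rewrite !mulr_sumr -!big_split; apply: ler_sum => x _ /=.
  rewrite uE /comb !mul1r.
  have /eqP := disj x; rewrite mulf_eq0 => /orP[] /eqP ->.
    by rewrite !mulr0 !add0r addr0 pot_scale_le.
  by rewrite !mulr0 !addr0 pot_scale_le.
have E1 := bform_ge0 epos w1; have E2 := bform_ge0 epos w2.
(* The exponent 4 is the degree of the b term. These two bounds are all that is kept of s^p and t^p
   in the estimate of the Dirichlet terms. *)
have hs := powR_sub1_div_le s0 (ltr0Sn R 3) (ltW p_gt4).
have ht := powR_sub1_div_le t0 (ltr0Sn R 3) (ltW p_gt4).
rewrite !powR_mulrn// in hs ht.
have Eu : E u u = E w1 w1 + E w2 w2 + 2 * E w1 w2.
  by rewrite uE bform_comb//; ring.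
have Eu1 : E u w1 = E w1 w1 + E w1 w2.
  by rewrite uE bform_combl (bformC esym w2); ring.
have Eu2 : E u w2 = E w2 w2 + E w1 w2.
  by rewrite uE bform_combl; ring.
rewrite /En /dEn bform_comb// Eu Eu1 Eu2.
move: hpot; set S1 := \sum_x _; set S2 := \sum_x _; set S3 := \sum_x _.
set S4 := \sum_x _.
move: S1 S2 S3 S4 => S1 S2 S3 S4 hpot.
have -> : (1 - s `^ p) / p = - ((s `^ p - 1) / p) by ring.
have -> : (1 - t `^ p) / p = - ((t `^ p - 1) / p) by ring.
move: hpot; rewrite (_ : (1 - s `^ p) / p = - ((s `^ p - 1) / p)); last by ring.
rewrite (_ : (1 - t `^ p) / p = - ((t `^ p - 1) / p)); last by ring.
move: ((s `^ p - 1) / p) ((t `^ p - 1) / p) hs ht => P T hs ht hpot.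
move: (E w1 w1) (E w2 w2) (E w1 w2) E1 E2 E12 => E1 E2 D E1_ge0 E2_ge0 D_ge0.
have hs2 : (s ^+ 2 - 1) / 2 + (s - 1) ^+ 2 / 4 <= P.
  apply: le_trans hs; rewrite -subr_ge0.
  rewrite (_ : _ - _ = (s - 1) ^+ 2 * (s * (s + 2)) / 4); last by field.
  by rewrite divr_ge0// mulr_ge0 ?sqr_ge0// mulr_ge0// addr_ge0.
have ht2 : (t ^+ 2 - 1) / 2 + (t - 1) ^+ 2 / 4 <= T.
  apply: le_trans ht; rewrite -subr_ge0.
  rewrite (_ : _ - _ = (t - 1) ^+ 2 * (t * (t + 2)) / 4); last by field.
  by rewrite divr_ge0// mulr_ge0 ?sqr_ge0// mulr_ge0// addr_ge0.
set N := E1 + E2 + 2 * D.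
set M := s ^+ 2 * E1 + t ^+ 2 * E2 + 2 * s * t * D.
have ha : M / 2 + (E1 * (s - 1) ^+ 2 + E2 * (t - 1) ^+ 2) / 4
    <= N / 2 + P * (E1 + D) + T * (E2 + D).
  (* The terms in D complete a square: s^2/2 + t^2/2 - s t = (s - t)^2 / 2. *)
  rewrite -subr_ge0 (_ : _ - _ =
      E1 * (P - ((s ^+ 2 - 1) / 2 + (s - 1) ^+ 2 / 4))
    + E2 * (T - ((t ^+ 2 - 1) / 2 + (t - 1) ^+ 2 / 4))
    + D * ((P - ((s ^+ 2 - 1) / 2 + (s - 1) ^+ 2 / 4))
         + (T - ((t ^+ 2 - 1) / 2 + (t - 1) ^+ 2 / 4))
         + (s - t) ^+ 2 / 2 + (s - 1) ^+ 2 / 4 + (t - 1) ^+ 2 / 4)); last first.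
    by rewrite /N /M; field.
  move: hs2 ht2; rewrite -subr_ge0 => hP; rewrite -subr_ge0 => hT.
  apply: addr_ge0; first by apply: addr_ge0; exact: mulr_ge0.
  apply: mulr_ge0 => //.
  by do ![apply: addr_ge0 => //]; rewrite divr_ge0 ?sqr_ge0.
have hb : M ^+ 2 / 4 <= N ^+ 2 / 4 + N * (P * (E1 + D) + T * (E2 + D)).
  have N0 : 0 <= N by rewrite /N; nra.
  have : N * ((s ^+ 4 - 1) / 4 * (E1 + D) + (t ^+ 4 - 1) / 4 * (E2 + D))
      <= N * (P * (E1 + D) + T * (E2 + D)).
    by rewrite ler_wpM2l// lerD// ler_wpM2r// addr_ge0.
  have M0 : 0 <= M by rewrite /M !addr_ge0 ?mulr_ge0 ?sqr_ge0.
  (* Cauchy-Schwarz for the weights E1 + D and E2 + D, of total mass N *)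
  have ME : M <= (E1 + D) * s ^+ 2 + (E2 + D) * t ^+ 2.
    rewrite -subr_ge0 (_ : _ - _ = D * (s - t) ^+ 2); last by rewrite /M; ring.
    by rewrite mulr_ge0 ?sqr_ge0.
  have : M ^+ 2 <= N * ((E1 + D) * s ^+ 4 + (E2 + D) * t ^+ 4).
    apply: (@le_trans _ _ (((E1 + D) * s ^+ 2 + (E2 + D) * t ^+ 2) ^+ 2)).
      by rewrite ler_sqr ?nnegrE// (le_trans M0).
    rewrite -subr_ge0 (_ : _ - _ = (E1 + D) * (E2 + D) * (s ^+ 2 - t ^+ 2) ^+ 2).
      by rewrite mulr_ge0 ?sqr_ge0// mulr_ge0// addr_ge0.
    by rewrite /N; ring.
  by rewrite /N; lra.
have := ler_wpM2l (ltW a_gt0) ha; have := ler_wpM2l b_ge0 hb.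
lra.
Qed.

(** If |w1| <= 1 everywhere, the potential part of [dEn u w1] is nonnegative and its Dirichlet part
    is positive. Since the threshold 1 does not depend on u, the conditions u <> 0, u+ <> 0 and u-
    <> 0 can be replaced by closed ones. *)
Lemma exists_gt1 : (exists x, w1 x != 0) -> dEn u w1 = 0 ->
  exists x, 1 < `|w1 x|.
Proof.
move=> w10 d0; apply: contrapT => /forallNP w1le.
have {}w1le x : `|w1 x| <= 1 by rewrite leNgt; apply/negP/w1le.
suff : 0 < dEn u w1 by rewrite d0 ltxx.
rewrite ltr_pwDl//; last first.
  apply: sumr_ge0 => x _; rewrite uE /comb !mul1r.
  have /eqP := disj x; rewrite mulf_eq0 => /orP[] /eqP ->; first by rewrite mulr0.
  by rewrite addr0 dpotM_ge0.
rewrite mulr_gt0//.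
  by rewrite ltr_pwDl// mulr_ge0// bform_ge0.
by rewrite uE bform_combl (bformC esym w2) !mul1r ltr_pwDl// epos.
Qed.

Lemma En_comb_le_crit s t : dEn u w1 = 0 -> dEn u w2 = 0 -> 0 <= s -> 0 <= t ->
  En (comb s t w1 w2) + a / 4 * (E w1 w1 * (s - 1) ^+ 2 + E w2 w2 * (t - 1) ^+ 2)
    <= En u.
Proof.
by move=> d1 d2 s0 t0; have := En_comb_le s0 t0; rewrite d1 d2 !mulr0 !addr0.
Qed.

End Decomposition.

(* At a point where |u| attains its maximum T, the term - B T^p ln T dominates
   all the others, which are O(T^p). *)
Lemma En_ge0_bounded : exists2 L, 1 <= L &
  forall u, 0 <= En u -> forall x, `|u x| <= L.
Proof.
pose C0 := \sum_x \sum_y `|e x y|.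
have C0_ge0 : 0 <= C0 by apply: sumr_ge0 => x _; apply: sumr_ge0.
pose K x := A x / q + B x / p ^+ 2 + B x / p.
pose C := a / 2 * C0 + b / 4 * C0 ^+ 2 + \sum_x K x.
(* Comparing the coefficients of T^p will give (B x0 / p) ln T <= C, that is T <= exp(C p / B x0).
   The sum serves every possible position x0 of the maximum, and the 1 covers T <= 1. *)
exists (1 + \sum_x expR (C * p / B x)).
  by rewrite lerDl sumr_ge0// => x _; rewrite expR_ge0.
move=> u u0 x.
have [x0 _ x0max] := @Order.TotalTheory.arg_maxP _ R X x predT (fun x => `|u x|) isT.
apply: le_trans (x0max x isT) _.
have {}x0max y : `|u y| <= `|u x0| by exact: x0max.
set T := `|u x0| in x0max *.
have [T1|T1] := leP T 1.
  by apply: le_trans T1 _; rewrite lerDl sumr_ge0// => y _; rewrite expR_ge0.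
suff TL : T <= expR (C * p / B x0).
  apply: le_trans TL _; rewrite (bigD1 x0)//= addrCA lerDl.
  by rewrite addr_ge0// sumr_ge0// => y _; rewrite expR_ge0.
have T0 : 0 < T by lra.
rewrite -[leLHS]lnK ?posrE// ler_expR ler_pdivlMr// -ler_pdivrMr//.
have Tp n : n%:R <= p -> T ^+ n <= T `^ p.
  by move=> np; rewrite -(powR_mulrn _ (ltW T0)) ler_powR// ltW.
have Tp_gt0 : 0 < T `^ p by rewrite powR_gt0.
have hE : E u u <= C0 * T ^+ 2 by exact: bform_le.
have hE1 : a / 2 * E u u <= a / 2 * C0 * T `^ p.
  rewrite -[leRHS]mulrA ler_wpM2l ?divr_ge0 ?(ltW a_gt0)//.
  apply: le_trans hE _.
  by rewrite ler_wpM2l// Tp//; move: p_gt4; lra.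
have hE2 : b / 4 * E u u ^+ 2 <= b / 4 * C0 ^+ 2 * T `^ p.
  rewrite -[leRHS]mulrA ler_wpM2l ?divr_ge0//.
  apply: (@le_trans _ _ ((C0 * T ^+ 2) ^+ 2)).
    apply: lerXn2r => //; rewrite nnegrE; first exact: bform_ge0.
    by rewrite mulr_ge0 ?sqr_ge0.
  by rewrite exprMn -exprM ler_wpM2l ?sqr_ge0// Tp// ltW.
have hpot : \sum_x pot p q (A x) (B x) (u x)
    <= (\sum_x K x) * T `^ p - B x0 / p * (T `^ p * ln T).
  have hx0 : pot p q (A x0) (B x0) (u x0)
      <= K x0 * T `^ p - B x0 / p * (T `^ p * ln T).
    rewrite /pot /K -/T.
    have : A x0 / q * T `^ q <= A x0 / q * T `^ p.
      by rewrite ler_wpM2l ?divr_ge0 ?(ltW q_gt0)// ler_powR// ltW.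
    have : 0 <= B x0 / p * T `^ p by rewrite mulr_ge0 ?divr_ge0 ?(ltW p_gt0) ?(ltW Tp_gt0).
    by lra.
  have hy : \sum_(y | y != x0) pot p q (A y) (B y) (u y)
      <= \sum_(y | y != x0) K y * T `^ p.
    by apply: ler_sum => y _; apply: pot_le => //; exact: ltW.
  rewrite (bigD1 x0)//= [in leRHS](bigD1 x0)//= mulrDl [leRHS]addrAC.
  by rewrite [in leRHS]mulr_suml; exact: lerD.
have : B x0 / p * (T `^ p * ln T) <= C * T `^ p.
  by move: u0; rewrite /En /C; lra.
rewrite mulrCA (mulrC C) ler_pM2l//.
by rewrite (_ : ln T * B x0 / p = B x0 / p * ln T)//; ring.
Qed.

Lemma dEn0r u : dEn u (fun=> 0) = 0.
Proof.
by rewrite /dEn bform0r mulr0 add0r big1// => x _; rewrite mulr0.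
Qed.

Lemma En0 : En (fun=> 0) = 0.
Proof.
rewrite /En bform0r mulr0 expr2 !mulr0 !add0r big1// => x _.
exact: pot0.
Qed.

(** * Maximisers over the cone and projection onto the constraint sets *)

Lemma box_max (w1 w2 : X -> R) L : 0 <= L ->
  exists s t, [/\ 0 <= s <= L, 0 <= t <= L & forall s' t',
    0 <= s' <= L -> 0 <= t' <= L ->
    En (comb s' t' w1 w2) <= En (comb s t w1 w2)].
Proof.
move=> L0.
pose f (z : R * R) := En (comb z.1 z.2 w1 w2).
have f_cont : {within `[0, L]%classic `*` `[0, L]%classic, continuous f}.
  apply: continuous_subspaceT => z; apply: cvg_En => x.
  apply: cvgD; apply: cvgM.
  - exact: cvg_fst.
  - exact: cvg_cst.
  - exact: cvg_snd.
  - exact: cvg_cst.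
have ne : `[0, L]%classic `*` `[0, L]%classic !=set0.
  by exists (0, 0); split; rewrite /= in_itv/= lexx.
have cpt := compact_setX (@segment_compact R 0 L) (@segment_compact R 0 L).
have [[s t] /set_mem[/= s_in t_in] zmax] := compact_EVT_max ne cpt f_cont.
exists s, t; split => [||s' t' s'_in t'_in].
- by move: s_in; rewrite in_itv.
- by move: t_in; rewrite in_itv.
- by apply: (zmax (s', t')); apply/mem_set; split; rewrite /= in_itv.
Qed.

(** The s-derivative may vanish at s = 0, so values are compared instead. The chosen s makes |s w1|
    <= 1: its potential and the cross term are then nonnegative, and s^2 E(w1, w1) is a strict
    gain. *)
Lemma En_comb_gt (w1 w2 : X -> R) t L : (forall x, w1 x * w2 x = 0) ->
  0 <= E w1 w2 -> (exists x, w1 x != 0) -> 0 <= t -> 0 < L ->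
  exists2 s, 0 < s <= L & En (comb 0 t w1 w2) < En (comb s t w1 w2).
Proof.
move=> disj E12 w10 t0 L0.
have S0 : 0 <= \sum_x `|w1 x| by exact: sumr_ge0.
pose s := Num.min L (1 + \sum_x `|w1 x|)^-1.
have s0 : 0 < s by rewrite lt_min L0 invr_gt0; lra.
exists s; first by rewrite s0 ge_min lexx.
have E1 := epos w10.
have hp : \sum_x pot p q (A x) (B x) (comb 0 t w1 w2 x)
    <= \sum_x pot p q (A x) (B x) (comb s t w1 w2 x).
  apply: ler_sum => x _; rewrite /comb mul0r add0r.
  have /eqP := disj x; rewrite mulf_eq0 => /orP[] /eqP ->.
    by rewrite mulr0 add0r.
  rewrite mulr0 addr0 pot0// pot_ge0// normrM gtr0_norm//.
  apply: (@le_trans _ _ ((1 + \sum_x `|w1 x|)^-1 * (\sum_x `|w1 x|))).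
    by apply: ler_pM; rewrite ?(ltW s0) ?ge_min ?lexx ?orbT ?ler_norm_sum_fin.
  by rewrite ler_pdivrMl; lra.
have hE : E (comb 0 t w1 w2) (comb 0 t w1 w2) + s ^+ 2 * E w1 w1
    <= E (comb s t w1 w2) (comb s t w1 w2).
  rewrite !bform_comb//.
  have : 0 <= 2 * s * t * E w1 w2 by rewrite !mulr_ge0// ltW.
  lra.
have E0 := bform_ge0 epos (comb 0 t w1 w2).
have sE : 0 < s ^+ 2 * E w1 w1 by rewrite mulr_gt0// exprn_gt0.
have h1 : a / 2 * E (comb 0 t w1 w2) (comb 0 t w1 w2)
   < a / 2 * E (comb s t w1 w2) (comb s t w1 w2).
  by rewrite ltr_pM2l ?divr_gt0//; lra.
have h2 : b / 4 * E (comb 0 t w1 w2) (comb 0 t w1 w2) ^+ 2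
   <= b / 4 * E (comb s t w1 w2) (comb s t w1 w2) ^+ 2.
  rewrite ler_wpM2l ?divr_ge0//; apply: lerXn2r; rewrite ?nnegrE//; lra.
rewrite /En; lra.
Qed.

(** The maximum is at least [En] at 0, which is 0, so the maximiser is bounded by L0; with s = L its
    value at x1, where w2 vanishes, would exceed L0. As [En_comb_gt] excludes s = 0, the maximum is
    interior in s. Only w1 is treated: swapping the two functions gives the other half. *)
Lemma box_max_crit (w1 w2 : X -> R) L L0 s t x1 : (forall x, w1 x * w2 x = 0) ->
  0 <= E w1 w2 -> w1 x1 != 0 ->
  (forall u, 0 <= En u -> forall x, `|u x| <= L0) ->
  L0 < L * `|w1 x1| -> 0 <= s <= L -> 0 <= t <= L ->
  (forall s' t', 0 <= s' <= L -> 0 <= t' <= L ->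
    En (comb s' t' w1 w2) <= En (comb s t w1 w2)) ->
  0 < s /\ dEn (comb s t w1 w2) w1 = 0.
Proof.
move=> disj E12 w10 L0P LL0 /andP[s0 sL] /andP[t0 tL] zmax.
have L0' : 0 <= L by lra.
have comb00 : comb 0 0 w1 w2 = fun=> 0.
  by apply/funext => x; rewrite /comb !mul0r addr0.
have z0 : 0 <= En (comb s t w1 w2).
  by rewrite -En0 -comb00; apply: zmax; rewrite lexx.
have w20 : w2 x1 = 0.
  by have /eqP := disj x1; rewrite mulf_eq0 (negbTE w10) => /eqP.
have sL' : s < L.
  rewrite lt_neqAle sL andbT; apply/negP => /eqP sE.
  have := L0P _ z0 x1; rewrite /comb w20 mulr0 addr0 normrM (ger0_norm s0) sE.
  by rewrite leNgt LL0.
have L_gt0 : 0 < L by lra.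
have s_gt0 : 0 < s.
  rewrite lt_neqAle s0 andbT; apply/negP => /eqP sE.
  have [|s' /andP[s'0 s'L]] := En_comb_gt disj E12 _ t0 L_gt0.
    by exists x1.
  by rewrite ltNge sE zmax// ?(ltW s'0)// t0.
split=> //.
have combE h : comb h t w1 w2 = comb 1 h (fun x => t * w2 x) w1.
  by apply/funext => x; rewrite /comb mul1r addrC.
have dE := is_derive1_En (fun x => t * w2 x) w1 s.
pose f h := En (comb 1 h (fun x => t * w2 x) w1).
have d0 : is_derive s 1 f 0.
  apply: (@derive1_at_max R f 0 L s); first exact: ltW.
  - by move=> h _; have [] := is_derive1_En (fun x => t * w2 x) w1 h.
  - by rewrite in_itv/= s_gt0.
  - move=> h; rewrite in_itv/= => /andP[h0 hL].
    by rewrite /f -!combE zmax// ?(ltW h0) ?(ltW hL)// t0.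
by rewrite combE; have [_ <-] := dE; have [_ <-] := d0.
Qed.

Lemma project_pair (w1 w2 : X -> R) : (forall x, w1 x * w2 x = 0) ->
  0 <= E w1 w2 -> (exists x, w1 x != 0) -> (exists x, w2 x != 0) ->
  exists s t, [/\ 0 < s, 0 < t, dEn (comb s t w1 w2) w1 = 0
    & dEn (comb s t w1 w2) w2 = 0].
Proof.
move=> disj E12 [x1 w1x] [x2 w2x]; have [L0 L0_ge1 L0P] := En_ge0_bounded.
have w1x' : 0 < `|w1 x1| by rewrite normr_gt0.
have w2x' : 0 < `|w2 x2| by rewrite normr_gt0.
(* Each summand is large enough for its own function; the sum makes one box serve both. *)
pose L := (L0 + 1) / `|w1 x1| + (L0 + 1) / `|w2 x2|.
have d1 : 0 < (L0 + 1) / `|w1 x1| by rewrite divr_gt0//; lra.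
have d2 : 0 < (L0 + 1) / `|w2 x2| by rewrite divr_gt0//; lra.
have LL1 : L0 < L * `|w1 x1|.
  rewrite -ltr_pdivrMr//; apply: (@lt_le_trans _ _ ((L0 + 1) / `|w1 x1|)).
    by rewrite ltr_pM2r ?invr_gt0//; lra.
  by rewrite /L; lra.
have LL2 : L0 < L * `|w2 x2|.
  rewrite -ltr_pdivrMr//; apply: (@lt_le_trans _ _ ((L0 + 1) / `|w2 x2|)).
    by rewrite ltr_pM2r ?invr_gt0//; lra.
  by rewrite /L; lra.
have [|s [t [s_in t_in zmax]]] := @box_max w1 w2 L; first by rewrite /L; lra.
have [s0 ds] := box_max_crit disj E12 w1x L0P LL1 s_in t_in zmax.
have disj' x : w2 x * w1 x = 0 by rewrite mulrC.
have E21 : 0 <= E w2 w1 by rewrite bformC.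
have [|t0 dt] := box_max_crit disj' E21 w2x L0P LL2 t_in s_in.
  by move=> s' t' s'_in t'_in; rewrite !(combC _ _ w2) zmax.
by exists s, t; split=> //; rewrite combC.
Qed.

Lemma project_one (w : X -> R) : (exists x, w x != 0) ->
  exists2 s, 0 < s & dEn (fun x => s * w x) (fun x => s * w x) = 0.
Proof.
move=> [x1 wx]; have [L0 L0_ge1 L0P] := En_ge0_bounded.
have wx' : 0 < `|w x1| by rewrite normr_gt0.
pose L := (L0 + 1) / `|w x1|.
have L_gt0 : 0 < L by rewrite divr_gt0//; lra.
have LL1 : L0 < L * `|w x1| by rewrite divfK ?gt_eqF//; lra.
have [|s [t [s_in t_in zmax]]] := @box_max w (fun=> 0) L; first exact: ltW.
have [||s0 ds] := @box_max_crit w (fun=> 0) L L0 s t x1 _ _ wx L0P LL1 s_in t_in zmax.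
- by move=> x; rewrite mulr0.
- by rewrite bform0r.
have combE : comb s t w (fun=> 0) = fun x => s * w x.
  by apply/funext => x; rewrite /comb mulr0 addr0.
exists s => //; rewrite -[X in dEn _ X]combE -combE dEn_linear ds dEn0r.
by rewrite !mulr0 addr0.
Qed.

(** * Compact boxes of functions, for pointwise convergence *)

Section Compactness.
Import ArrowAsProduct.

Lemma compact_box (L : R) : compact [set u : X -> R | forall x, `[- L, L]%classic (u x)].
Proof.
by apply: (@tychonoff X (fun=> R : topologicalType) (fun=> `[- L, L]%classic)) => x;
  exact: segment_compact.
Qed.

Lemma proj_cvg (u : X -> R) x : (w : X -> R) x @[w --> u] --> u x.
Proof. exact: (@proj_continuous X (fun=> R : topologicalType) x). Qed.

Lemma continuous_En : continuous (En : (X -> R) -> R).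
Proof.
by move=> u; apply: (@cvg_En (X -> R) (nbhs u) (nbhs_filter u) (fun w => w) u) => x;
  exact: proj_cvg.
Qed.

Lemma continuous_dEn (f : R -> R) : continuous f ->
  continuous ((fun u => dEn u (f \o u)) : (X -> R) -> R).
Proof.
move=> cf u; apply: (@cvg_dEn (X -> R) (nbhs u) (nbhs_filter u) (fun w => w)
  (fun w : X -> R => f \o w) u (f \o u)) => x; first exact: proj_cvg.
exact: (continuous_cvg _ (cf (u x)) (@proj_cvg u x)).
Qed.

Lemma dEn_bounded (v : X -> R) L : 0 <= L ->
  exists2 C, 0 < C & forall u, (forall x, `|u x| <= L) -> dEn u v <= C.
Proof.
move=> L0; have ne : [set u : X -> R | forall x, `[- L, L]%classic (u x)] !=set0.
  by exists (fun=> 0) => x /=; rewrite in_itv/= oppr_le0 L0.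
have [|w _ wmax] := compact_EVT_max (f := fun u => dEn u v) ne (@compact_box L).
  apply: continuous_subspaceT => u.
  by apply: (@cvg_dEn (X -> R) (nbhs u) (nbhs_filter u) (fun w => w) (fun=> v)) => x;
    [exact: proj_cvg|exact: cvg_cst].
exists (1 + `|dEn w v|); first by have := normr_ge0 (dEn w v); lra.
move=> u uL; have := ler_norm (dEn w v).
have : dEn u v <= dEn w v.
  by apply/wmax/mem_set => x /=; rewrite in_itv/= -ler_norml.
lra.
Qed.

(** Nonnegative energy confines S to the box of [En_ge0_bounded], so closedness already gives
    compactness. *)
Lemma ex_minimizer (S : set (X -> R)) : S !=set0 -> closed S ->
  (forall u, S u -> 0 <= En u) ->
  exists2 u, S u & forall w, S w -> En u <= En w.
Proof.
move=> S0 Scl Sge; have [L L1 LP] := En_ge0_bounded.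
have Scpt : compact S.
  apply: (subclosed_compact Scl (@compact_box L)) => u Su x /=.
  by rewrite in_itv/= -ler_norml LP// Sge.
have [|u /set_mem Su umin] := compact_EVT_min (f := En) S0 Scpt.
  by apply: continuous_subspaceT; exact: continuous_En.
by exists u => // w Sw; apply/umin/mem_set.
Qed.

Lemma closed_dEn (f : R -> R) : continuous f ->
  closed [set u : X -> R | dEn u (f \o u) = 0].
Proof.
move=> cf; apply: (preimage_closed (f := fun u => dEn u (f \o u)) (D := [set 0])).
  by move=> u _; exact: continuous_dEn.
exact: closed_eq.
Qed.

(** Applied to |r|, max(r, 0) and -min(r, 0): the closed form of nonvanishing made possible by
    [exists_gt1]. *)
Lemma closed_sum_ge1 (f : R -> R) : continuous f ->
  closed [set u : X -> R | 1 <= \sum_x f (u x)].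
Proof.
move=> cf.
apply: (preimage_closed (f := fun u => \sum_x f (u x)) (D := [set y | 1 <= y])).
  move=> u _; apply: (@cvg_sum_seq R (X -> R) X (nbhs u) (nbhs_filter u) _
    (fun x w => f (w x)) (fun x => f (u x))) => x.
  exact: (continuous_cvg _ (cf (u x)) (@proj_cvg u x)).
exact: closed_ge.
Qed.

End Compactness.

(** * A first-order condition obtained from nearby competitors *)

Lemma bform_ge_sq (w : X -> R) :
  exists2 c, 0 < c & forall x, c * w x ^+ 2 <= E w w.
Proof.
have [w0|w0] := pselect (exists x, w x != 0); last first.
  exists 1 => // x; rewrite mul1r (_ : w x = 0) ?expr0n ?bform_ge0//.
  by apply/eqP/negP => /negP wx; apply: w0; exists x.
have S0 : 0 <= \sum_x `|w x| by exact: sumr_ge0.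
have S1 : 0 < (1 + \sum_x `|w x|) ^+ 2 by rewrite exprn_gt0//; lra.
exists (E w w / (1 + \sum_x `|w x|) ^+ 2); first by rewrite divr_gt0// epos.
move=> x; rewrite -mulrA ler_piMr ?bform_ge0// ler_pdivrMl// mulr1.
rewrite -[w x ^+ 2]real_normK ?num_real//; apply: lerXn2r; rewrite ?nnegrE//.
  by lra.
by have := ler_norm_sum_fin w x; lra.
Qed.

(** Turns the energy surplus into pointwise closeness. The constant may depend on w1 and w2, which
    stay fixed while s and t vary; disjoint supports leave no product term in the square. *)
Lemma comb_dist (u w1 w2 : X -> R) : (forall x, w1 x * w2 x = 0) ->
  u = comb 1 1 w1 w2 -> exists2 c, 0 < c & forall s t x,
    c * (comb s t w1 w2 x - u x) ^+ 2
      <= a / 4 * (E w1 w1 * (s - 1) ^+ 2 + E w2 w2 * (t - 1) ^+ 2).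
Proof.
move=> disj uE; have [c1 c1_gt0 h1] := bform_ge_sq w1.
have [c2 c2_gt0 h2] := bform_ge_sq w2.
have c_gt0 : 0 < Num.min c1 c2 by rewrite lt_min c1_gt0.
exists (a / 4 * Num.min c1 c2); first by rewrite mulr_gt0// divr_gt0.
move=> s t x; rewrite -[leLHS]mulrA ler_wpM2l ?divr_ge0 ?(ltW a_gt0)//.
have -> : (comb s t w1 w2 x - u x) ^+ 2
    = (s - 1) ^+ 2 * w1 x ^+ 2 + (t - 1) ^+ 2 * w2 x ^+ 2.
  rewrite (_ : comb s t w1 w2 x - u x = (s - 1) * w1 x + (t - 1) * w2 x); last first.
    by rewrite uE /comb; ring.
  have /eqP := disj x; rewrite mulf_eq0 => /orP[] /eqP ->; ring.
move: (Num.min c1 c2) c_gt0 (ge_min c1 c1 c2) (ge_min c2 c1 c2).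
rewrite !lexx orbT /= => c c_gt0 cc1 cc2.
rewrite (_ : c * _ = c * w1 x ^+ 2 * (s - 1) ^+ 2 + c * w2 x ^+ 2 * (t - 1) ^+ 2);
  last by ring.
apply: lerD; apply: ler_wpM2r; rewrite ?sqr_ge0//.
  by apply: le_trans (h1 x); rewrite ler_wpM2r ?sqr_ge0.
by apply: le_trans (h2 x); rewrite ler_wpM2r ?sqr_ge0.
Qed.

(* The mean value theorem on the segment from [y] to [y + eps s v] gives a
   point where the derivative along [v] is nonnegative; the quadratic estimate
   forces [y], hence that point, to tend to [u] with [eps]. *)
Lemma dEn_ge0_of_approx u v c L eps0 : 0 < c -> 0 < eps0 -> 0 <= En u ->
  (forall eps, 0 < eps -> eps < eps0 -> exists (y : X -> R) (s : R),
    [/\ 0 < s <= L, forall x, c * (y x - u x) ^+ 2 <= En u - En y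
      & En u <= En (comb 1 (eps * s) y v)]) ->
  0 <= dEn u v.
Proof.
move=> c0 eps0_gt0 u0 H; have [L0 L0_ge1 L0P] := En_ge0_bounded.
pose V := 1 + \sum_x `|v x|.
have V_ge1 : 1 <= V by rewrite lerDl sumr_ge0.
have vV x : `|v x| <= V by have := ler_norm_sum_fin v x; rewrite /V; lra.
have L_gt0 : 0 < L.
  have [] := H (eps0 / 2); [lra|lra|move=> y [s [/andP[s0 sL] _ _]]; lra].
have eLV : 0 < eps0 * L * V by rewrite !mulr_gt0//; lra.
(* The end point y + eps s v has nonnegative energy, hence is bounded by L0; y differs from it by at
   most eps0 L V, and a point of the segment differs from y by at most as much again. *)
have [|C C0 CP] := @dEn_bounded v (L0 + eps0 * L * V + eps0 * L * V); first lra.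
have approx d : 0 < d -> exists2 xi, 0 <= dEn xi v & forall x, `|xi x - u x| <= d.
  move=> d0.
  (* The three bounds make eps admissible, give En u - En y <= C L eps <= c (d/2)^2 and hence |y -
     u| <= d/2, and keep the displacement h v below d/2. *)
  pose eps := Num.min (eps0 / 2) (Num.min (c * (d / 2) ^+ 2 / (C * L)) (d / 2 / (L * V))).
  have LV0 : 0 < L * V by rewrite mulr_gt0//; lra.
  have CL0 : 0 < C * L by rewrite mulr_gt0.
  have eps_gt0 : 0 < eps.
    by rewrite !lt_min !divr_gt0 ?mulr_gt0 ?exprn_gt0 ?divr_gt0//; lra.
  have eps_lt : eps < eps0.
    apply: (@le_lt_trans _ _ (eps0 / 2)); last by lra.
    by rewrite ge_min lexx.
  have eps1 : C * L * eps <= c * (d / 2) ^+ 2.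
    by rewrite mulrC -ler_pdivlMr// !ge_min lexx orbT.
  have eps2 : L * V * eps <= d / 2.
    by rewrite mulrC -ler_pdivlMr// !ge_min lexx !orbT.
  have [y [s [/andP[s0 sL] yu uz]]] := H eps eps_gt0 eps_lt.
  have es0 : 0 < eps * s by rewrite mulr_gt0.
  have esL : eps * s <= eps * L by rewrite ler_pM2l.
  have eL0 : eps * L <= eps0 * L by rewrite ler_pM2r// ltW.
  have hv h x : 0 <= h <= eps * s -> `|h * v x| <= eps * L * V.
    move=> /andP[h0 hs]; rewrite normrM (ger0_norm h0).
    by apply: ler_pM => //; exact: le_trans esL.
  have eLV' : eps * L * V <= eps0 * L * V by rewrite ler_pM2r//; lra.
  have yL x : `|y x| <= L0 + eps0 * L * V.
    have h1 := L0P _ (le_trans u0 uz) x.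
    have := hv (eps * s) x; rewrite lexx (ltW es0) => /(_ isT) h2.
    have -> : y x = comb 1 (eps * s) y v x - eps * s * v x by rewrite /comb; ring.
    by have := ler_normB (comb 1 (eps * s) y v x) (eps * s * v x); lra.
  pose f h := En (comb 1 h y v).
  have [|||h h_in fE] := @MVT_segment R f (fun h => dEn (comb 1 h y v) v) 0 (eps * s).
  - exact: ltW.
  - by move=> h _; exact: is_derive1_En.
  - apply: continuous_subspaceT => h.
    apply/differentiable_continuous/derivable1_diffP.
    by have [] := is_derive1_En y v h.
  have {}h_in : 0 <= h <= eps * s by move: h_in; rewrite in_itv.
  have f0 : f 0 = En y.
    by congr En; apply/funext => x; rewrite /comb mul1r mul0r addr0.
  rewrite f0 subr0 {1}/f in fE.
  have xiL x : `|comb 1 h y v x| <= L0 + eps0 * L * V + eps0 * L * V.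
    rewrite /comb mul1r; have := ler_normD (y x) (h * v x).
    by have := yL x; have := hv h x h_in; lra.
  have dC := CP _ xiL.
  (* En y <= En u is read off the hypothesis at some vertex, so the empty type, where [dEn u v] is
     an empty sum, is set aside. *)
  have [x1|X0] := pselect (inhabited X); last first.
    exists u; last by move=> x; rewrite subrr normr0 ltW.
    rewrite /dEn /bform !big1 ?mulr0 ?addr0// => x _; exfalso; exact: X0 (inhabits x).
  have Eyu x : c * (y x - u x) ^+ 2 <= En u - En y by exact: yu.
  have fpos : 0 <= En u - En y.
    by case: x1 => x; apply: le_trans (Eyu x); rewrite mulr_ge0 ?sqr_ge0// ltW.
  exists (comb 1 h y v).
    by rewrite -(pmulr_lge0 _ es0) -fE; lra.
  move=> x.
  have hd : En u - En y <= c * (d / 2) ^+ 2.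
    apply: (@le_trans _ _ (dEn (comb 1 h y v) v * (eps * s))); first by rewrite -fE; lra.
    apply: le_trans eps1.
    apply: (@le_trans _ _ (C * (eps * s))); first by rewrite ler_pM2r.
    by rewrite -mulrA ler_pM2l// mulrC ler_pM2r.
  have yd : `|y x - u x| <= d / 2.
    have : (y x - u x) ^+ 2 <= (d / 2) ^+ 2.
      by rewrite -(ler_pM2l c0); exact: le_trans (Eyu x) hd.
    rewrite -[(y x - u x) ^+ 2]real_normK ?num_real// ler_sqr ?nnegrE//.
    by rewrite divr_ge0// ltW.
  have -> : comb 1 h y v x - u x = (y x - u x) + h * v x by rewrite /comb; ring.
  apply: le_trans (ler_normD _ _) _.
  have := hv h x h_in; have : eps * L * V = L * V * eps by ring.
  lra.
have /choice[xi xiP] : forall n : nat, exists xi, 0 <= dEn xi v /\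
    forall x, `|xi x - u x| <= harmonic n.
  by move=> n; have [xi] := approx (harmonic n) (harmonic_gt0 n); exists xi.
have cxi x : xi n x @[n --> \oo] --> u x.
  have H0 : xi n x - u x @[n --> \oo] --> 0.
    apply/norm_cvg0P; apply: (squeeze_cvgr _ (cvg_cst 0) cvg_harmonic).
    by near=> n; rewrite normr_ge0/=; have [_] := xiP n.
  have -> : (fun n => xi n x) = (fun n => xi n x - u x + u x).
    by apply/funext => n; rewrite subrK.
  have H1 : (xi n x - u x) + u x @[n --> \oo] --> 0 + u x.
    by apply: cvgD => //; exact: cvg_cst.
  by rewrite add0r in H1.
have cd : dEn (xi n) v @[n --> \oo] --> dEn u v.
  by apply: cvg_dEn => // x; exact: cvg_cst.
rewrite -(cvg_lim (@Rhausdorff R) cd); apply: limr_ge.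
  by apply/cvg_ex; exists (dEn u v).
by near=> n; have [] := xiP n.
Unshelve. all: by end_near. Qed.

Lemma dEnZ u s (w : X -> R) : dEn u (fun x => s * w x) = s * dEn u w.
Proof.
rewrite (_ : (fun x => _) = comb s 0 w w); first by rewrite dEn_linear mul0r addr0.
by apply/funext => x; rewrite /comb mul0r addr0.
Qed.

Lemma bformZ s (w : X -> R) :
  E (fun x => s * w x) (fun x => s * w x) = s ^+ 2 * E w w.
Proof.
rewrite (_ : (fun x => _) = comb s 0 w w); first by rewrite bform_comb//; ring.
by apply/funext => x; rewrite /comb mul0r addr0.
Qed.

(** * Positive and negative parts; the two constraint sets and their minimisers *)

Lemma pos_neg_disj u x : pos_part u x * neg_part u x = 0.
Proof.
rewrite /pos_part /neg_part; have [u0|u0] := leP 0 (u x).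
  by rewrite mulr0.
by rewrite mul0r.
Qed.

Lemma pos_neg_comb u : u = comb 1 1 (pos_part u) (neg_part u).
Proof. by apply/funext => x; rewrite /comb !mul1r /pos_part /neg_part addr_max_min addr0. Qed.

Lemma bform_pos_neg_ge0 u : 0 <= E (pos_part u) (neg_part u).
Proof.
apply: bform_opp_sign_ge0 => //; last exact: pos_neg_disj.
  by move=> x; rewrite le_max lexx orbT.
by move=> x; rewrite ge_min lexx orbT.
Qed.

Lemma pos_part_comb s t (w : X -> R) : 0 <= s -> 0 <= t ->
  pos_part (comb s t (pos_part w) (neg_part w)) = fun x => s * pos_part w x.
Proof.
move=> s0 t0; apply/funext => x; rewrite {1}/pos_part /comb.
have h1 : 0 <= pos_part w x by rewrite le_max lexx orbT.
have h2 : neg_part w x <= 0 by rewrite ge_min lexx orbT.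
have /eqP := pos_neg_disj w x; rewrite mulf_eq0 => /orP[] /eqP ->.
  by rewrite !mulr0 add0r; apply/max_idPr; exact: mulr_ge0_le0.
by rewrite mulr0 addr0; apply/max_idPl; exact: mulr_ge0.
Qed.

Lemma neg_part_comb s t (w : X -> R) : 0 <= s -> 0 <= t ->
  neg_part (comb s t (pos_part w) (neg_part w)) = fun x => t * neg_part w x.
Proof.
move=> s0 t0; apply/funext => x; rewrite {1}/neg_part /comb.
have h1 : 0 <= pos_part w x by rewrite le_max lexx orbT.
have h2 : neg_part w x <= 0 by rewrite ge_min lexx orbT.
have /eqP := pos_neg_disj w x; rewrite mulf_eq0 => /orP[] /eqP ->.
  by rewrite mulr0 add0r; apply/min_idPl; exact: mulr_ge0_le0.
by rewrite !mulr0 addr0; apply/min_idPr; exact: mulr_ge0.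
Qed.

Definition on_nehari u := (exists x, u x != 0) /\ dEn u u = 0.

Definition on_nodal u := [/\ exists x, 0 < u x, exists x, u x < 0,
  dEn u (pos_part u) = 0 & dEn u (neg_part u) = 0].

Lemma on_nehariP u : on_nehari u -> exists x, 1 < `|u x|.
Proof.
move=> [u0 du]; apply: (@exists_gt1 u u (fun=> 0)) => //.
- by move=> x; rewrite mulr0.
- by rewrite bform0r.
- by apply/funext => x; rewrite /comb; ring.
Qed.

Lemma on_nehari_scale_le u s : on_nehari u -> 0 <= s ->
  En (fun x => s * u x) + a / 4 * (E u u * (s - 1) ^+ 2) <= En u.
Proof.
move=> [_ du] s0; have := @En_comb_le_crit u u (fun=> 0) _ _ _ s 1.
rewrite !bform0r mul0r addr0 (_ : comb s 1 u _ = fun x => s * u x); last first.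
  by apply/funext => x; rewrite /comb; ring.
apply=> //; last exact: dEn0r.
- by move=> x; rewrite mulr0.
- by apply/funext => x; rewrite /comb; ring.
Qed.

Lemma on_nehari_ge0 u : on_nehari u -> 0 <= En u.
Proof.
move=> Nu; have := on_nehari_scale_le Nu (lexx 0).
rewrite (_ : (fun _ => _) = fun=> 0) ?En0; last by apply/funext => x; rewrite mul0r.
apply: le_trans; rewrite add0r mulr_ge0 ?divr_ge0 ?(ltW a_gt0)//.
by rewrite mulr_ge0 ?sqr_ge0// bform_ge0.
Qed.

Lemma on_nodal_scale_le u s t : on_nodal u -> 0 <= s -> 0 <= t ->
  En (comb s t (pos_part u) (neg_part u))
  + a / 4 * (E (pos_part u) (pos_part u) * (s - 1) ^+ 2
           + E (neg_part u) (neg_part u) * (t - 1) ^+ 2) <= En u.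
Proof.
move=> [_ _ d1 d2]; apply: En_comb_le_crit => //.
- exact: pos_neg_disj.
- exact: bform_pos_neg_ge0.
- exact: pos_neg_comb.
Qed.

Lemma on_nodal_ge0 u : on_nodal u -> 0 <= En u.
Proof.
move=> Mu; have := on_nodal_scale_le Mu (lexx 0) (lexx 0).
rewrite (_ : comb _ _ _ _ = fun=> 0) ?En0; last first.
  by apply/funext => x; rewrite /comb !mul0r addr0.
apply: le_trans; rewrite add0r mulr_ge0 ?divr_ge0 ?(ltW a_gt0)//.
by rewrite addr_ge0// mulr_ge0 ?sqr_ge0// bform_ge0.
Qed.

Lemma pos_part_neq0 u x : (pos_part u x != 0) = (0 < u x).
Proof.
rewrite /pos_part; have [u0|u0] := leP (u x) 0; first by rewrite eqxx.
by rewrite gt_eqF.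
Qed.

Lemma neg_part_neq0 u x : (neg_part u x != 0) = (u x < 0).
Proof.
rewrite /neg_part; have [u0|u0] := leP 0 (u x); first by rewrite eqxx.
by rewrite lt_eqF.
Qed.

Lemma on_nodalP u : on_nodal u -> (exists x, 1 < u x) /\ (exists x, u x < -1).
Proof.
move=> [[x0 ux0] [y0 uy0] d1 d2]; split.
  have [|||x] := @exists_gt1 u (pos_part u) (neg_part u) (pos_neg_disj u) _ (pos_neg_comb u).
  - exact: bform_pos_neg_ge0.
  - by exists x0; rewrite pos_part_neq0.
  - by [].
  rewrite /pos_part ger0_norm ?le_max ?lexx ?orbT// => h; exists x.
  by move: h; rewrite lt_max => /orP[//|]; lra.
have disj x : neg_part u x * pos_part u x = 0 by rewrite mulrC pos_neg_disj.
have uE : u = comb 1 1 (neg_part u) (pos_part u) by rewrite combC -pos_neg_comb.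
have [|||x] := @exists_gt1 u (neg_part u) (pos_part u) disj _ uE.
- by rewrite bformC// bform_pos_neg_ge0.
- by exists y0; rewrite neg_part_neq0.
- by [].
rewrite /neg_part ler0_norm ?ge_min ?lexx ?orbT// => h; exists x.
by move: h; rewrite ltrNr gt_min => /orP[//|]; lra.
Qed.

Lemma project_nehari (w : X -> R) : (exists x, w x != 0) ->
  exists2 s, 0 < s & on_nehari (fun x => s * w x).
Proof.
move=> w0; have [s s0 ds] := project_one w0; exists s => //; split=> //.
by case: w0 => x wx; exists x; rewrite mulf_neq0// gt_eqF.
Qed.

Lemma project_nodal (w : X -> R) : (exists x, 0 < w x) -> (exists x, w x < 0) ->
  exists s t, [/\ 0 < s, 0 < t & on_nodal (comb s t (pos_part w) (neg_part w))].
Proof.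
move=> [x wx] [y wy].
have [||s [t [s0 t0 d1 d2]]] := @project_pair (pos_part w) (neg_part w)
  (pos_neg_disj w) (bform_pos_neg_ge0 w).
- by exists x; rewrite pos_part_neq0.
- by exists y; rewrite neg_part_neq0.
exists s, t; split=> //; have s0' := ltW s0; have t0' := ltW t0.
split; last 2 first.
- by rewrite pos_part_comb// dEnZ d1 mulr0.
- by rewrite neg_part_comb// dEnZ d2 mulr0.
- exists x; rewrite -pos_part_neq0 pos_part_comb// mulf_neq0// ?pos_part_neq0//.
  by rewrite gt_eqF.
- exists y; rewrite -neg_part_neq0 neg_part_comb// mulf_neq0// ?neg_part_neq0//.
  by rewrite gt_eqF.
Qed.

Lemma ex_nehari_min : inhabited X ->
  exists2 u, on_nehari u & forall w, on_nehari w -> En u <= En w.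
Proof.
move=> [x0].
(* Among solutions of dEn u u = 0, being nonzero is equivalent to this closed condition, by
   [on_nehariP]. *)
pose S : set (X -> R) := [set u | 1 <= \sum_x `|u x|]
  `&` [set u | dEn u (id \o u) = 0].
have SP u : S u <-> on_nehari u.
  split=> [[/= u1 du]|Nu]; last first.
    split; last by case: Nu.
    have [x ux] := on_nehariP Nu.
    by apply: (le_trans (ltW ux)); exact: ler_norm_sum_fin.
  split=> //; apply: contrapT => /forallNP u0.
  move: u1; rewrite big1 ?ler10// => x _.
  by apply/eqP; rewrite normr_eq0; apply/negP => /negP; exact: u0.
have [|||u /SP Nu umin] := @ex_minimizer S.
- have [|s _ Ns] := @project_nehari (fun=> 1); first by exists x0; exact: oner_neq0.
  by exists (fun x => s * 1); apply/SP.
- apply: closedI; first by apply: closed_sum_ge1; exact: norm_continuous.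
  by apply: closed_dEn => r; exact: cvg_id.
- by move=> u /SP; exact: on_nehari_ge0.
by exists u => // w /SP; exact: umin.
Qed.

Lemma ex_nodal_min : (exists x y : X, x <> y) ->
  exists2 u, on_nodal u & forall w, on_nodal w -> En u <= En w.
Proof.
move=> [x0 [y0 /eqP xy]].
pose f1 (r : R) := Num.max r 0; pose f2 (r : R) := Num.min r 0.
have cf1 : continuous f1.
  by move=> r; apply: continuous_max; [exact: cvg_id|exact: cvg_cst].
have cf2 : continuous f2.
  by move=> r; apply: continuous_min; [exact: cvg_id|exact: cvg_cst].
pose S : set (X -> R) := ([set u | 1 <= \sum_x f1 (u x)]
  `&` [set u | 1 <= \sum_x (- f2 (u x))])
  `&` ([set u | dEn u (f1 \o u) = 0] `&` [set u | dEn u (f2 \o u) = 0]).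
have f1_ge0 r : 0 <= f1 r by rewrite le_max lexx orbT.
have f2_le0 r : f2 r <= 0 by rewrite ge_min lexx orbT.
have SP u : S u <-> on_nodal u.
  split=> [[[/= u1 u2] [/= d1 d2]]|Mu]; last first.
    split; last by case: Mu.
    have [[x ux] [y uy]] := on_nodalP Mu; split=> /=.
      rewrite (bigD1 x)//= (le_trans (ltW ux))// (@le_trans _ _ (f1 (u x)))//.
        by rewrite le_max lexx.
      by rewrite lerDl sumr_ge0.
    rewrite (bigD1 y)//= (@le_trans _ _ (- f2 (u y)))//.
      by rewrite lerNr ge_min ltW.
    by rewrite lerDl sumr_ge0// => z _; rewrite oppr_ge0.
  split=> //; apply: contrapT => /forallNP u0.
    move: u1; rewrite big1 ?ler10// => x _; apply/max_idPr.
    by rewrite leNgt; apply/negP/u0.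
  move: u2; rewrite big1 ?ler10// => x _; apply/eqP; rewrite oppr_eq0.
  by apply/eqP/min_idPr; rewrite leNgt; apply/negP/u0.
have [|||u /SP Mu umin] := @ex_minimizer S.
(* Two distinct vertices provide a sign-changing seed whose projection shows that S is nonempty. *)
- have [||s [t [_ _ Mz]]] := @project_nodal
    (fun x => if x == x0 then 1 else if x == y0 then -1 else 0).
  + by exists x0; rewrite eqxx.
  + by exists y0; rewrite eq_sym (negbTE xy) eqxx ltrN10.
  by eexists; apply/SP; exact: Mz.
- apply: closedI; first apply: closedI.
  + exact: closed_sum_ge1.
  + apply: (@closed_sum_ge1 (fun r => - f2 r)) => r.
    by apply: cvgN; exact: cf2.
  + by apply: closedI; exact: closed_dEn.
- by move=> u /SP; exact: on_nodal_ge0.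
by exists u => // w /SP; exact: umin.
Qed.

(** * Minimisers over the constraint sets are critical *)

Lemma nehari_min_crit u (v : X -> R) : on_nehari u ->
  (forall w, on_nehari w -> En u <= En w) -> 0 <= dEn u v.
Proof.
move=> Nu umin; have [L0 L0_ge1 L0P] := En_ge0_bounded.
have [x1 ux1] := on_nehariP Nu; have u0 := on_nehari_ge0 Nu.
have [||c c0 cP] := @comb_dist u u (fun=> 0).
- by move=> x; rewrite mulr0.
- by apply/funext => x; rewrite /comb; ring.
pose V := 1 + \sum_x `|v x|.
have V_ge1 : 1 <= V by rewrite lerDl sumr_ge0.
have vV x : `|v x| <= V by have := ler_norm_sum_fin v x; rewrite /V; lra.
apply: (@dEn_ge0_of_approx u v c (2 * L0) (2 * V)^-1) => //.
  by rewrite invr_gt0; lra.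
(* As |u x1| > 1 and |eps v x1| < 1/2, |w x1| > 1/2; the projected s w is bounded by L0, hence s <=
   2 L0. The projection being a mere scaling, s w = s u + eps s v for an arbitrary v. *)
move=> eps eps0 epsV.
have ev : `|eps * v x1| < 1 / 2.
  rewrite normrM gtr0_norm//; apply: (@le_lt_trans _ _ (eps * V)).
    by rewrite ler_pM2l.
  move: epsV; rewrite -[X in _ < X]div1r ltr_pdivlMr; lra.
pose w := comb 1 eps u v.
have wE x : w x = u x + eps * v x by rewrite /w /comb mul1r.
have wx1 : 1 / 2 < `|w x1|.
  by rewrite wE; have := lerB_normD (u x1) (eps * v x1); lra.
have [|s s0 Ns] := @project_nehari w.
  by exists x1; rewrite -normr_gt0; lra.
have Ns_min := umin _ Ns.
exists (fun x => s * u x), s; split.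
- rewrite s0 /=.
  have := L0P _ (le_trans u0 Ns_min) x1; rewrite normrM gtr0_norm// => h.
  have : s * (1 / 2) <= s * `|w x1| by rewrite ler_pM2l// ltW.
  lra.
- move=> x; have := on_nehari_scale_le Nu (ltW s0); have := cP s 1 x.
  rewrite bform0r mul0r addr0.
  have -> : comb s 1 u (fun=> 0) x = s * u x by rewrite /comb; ring.
  lra.
- rewrite (_ : comb 1 (eps * s) _ v = fun x => s * w x)//.
  by apply/funext => x; rewrite /w /comb; ring.
Qed.

(** The projection scales w+ and w- by different factors, so writing it as s u+ + t u- plus a
    multiple of v requires that no vertex pass from one strict sign to the other. Moving the single
    vertex x0 by less than |u x0| ensures this; if u x0 = 0, either sign is harmless. *)
Lemma nodal_min_crit u x0 (tau : R) : on_nodal u ->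
  (forall w, on_nodal w -> En u <= En w) ->
  0 <= dEn u (fun x => if x == x0 then tau else 0).
Proof.
move=> Mu umin; have [L0 L0_ge1 L0P] := En_ge0_bounded.
have [[x1 ux1] [x2 ux2]] := on_nodalP Mu; have u0 := on_nodal_ge0 Mu.
have [c c0 cP] := comb_dist (pos_neg_disj u) (pos_neg_comb u).
pose v x := if x == x0 then tau else 0.
have vV x : `|v x| <= `|tau| by rewrite /v; case: ifP => // _; rewrite normr0.
(* The bound 1/2 keeps w > 1/2 at x1 and w < -1/2 at x2, whence s, t <= 2 L0; the bound |u x0|
   preserves the sign at x0. *)
pose m := if u x0 == 0 then 1 / 2 else Num.min (1 / 2) `|u x0|.
have m0 : 0 < m.
  by rewrite /m; case: ifPn => [_|h]; [lra|rewrite lt_min normr_gt0 h andbT; lra].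
have m12 : m <= 1 / 2 by rewrite /m; case: ifP => // _; rewrite ge_min lexx.
have tau1 : 0 < 1 + `|tau| by have := normr_ge0 tau; lra.
apply: (@dEn_ge0_of_approx u v c (2 * L0) (m / (1 + `|tau|))) => //.
  by rewrite divr_gt0.
move=> eps eps0 epsV.
have em : eps * `|tau| < m.
  move: epsV; rewrite ltr_pdivlMr// mulrDr mulr1; lra.
have ev x : `|eps * v x| < m.
  rewrite normrM gtr0_norm//; apply: le_lt_trans em.
  by rewrite ler_pM2l.
pose w := comb 1 eps u v.
have wE x : w x = u x + eps * v x by rewrite /w /comb mul1r.
have wx1 : 1 / 2 < w x1.
  by have := ev x1; rewrite wE ltr_norml => /andP[]; lra.
have wx2 : w x2 < - (1 / 2).
  by have := ev x2; rewrite wE ltr_norml => /andP[]; lra.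
have [||s [t [s0 t0 Mz]]] := @project_nodal w.
- by exists x1; lra.
- by exists x2; lra.
have Mz_min := umin _ Mz.
have zL := L0P _ (le_trans u0 Mz_min).
have sL : s <= 2 * L0.
  have := zL x1; rewrite /comb /pos_part /neg_part.
  rewrite (max_idPl _) ?(min_idPr _) ?mulr0 ?addr0; [|lra|lra].
  rewrite normrM gtr0_norm// gtr0_norm; last by lra.
  have : s * (1 / 2) <= s * w x1 by rewrite ler_pM2l// ltW.
  lra.
have tL : t <= 2 * L0.
  have := zL x2; rewrite /comb /pos_part /neg_part.
  rewrite (max_idPr _) ?(min_idPl _) ?mulr0 ?add0r; [|lra|lra].
  rewrite normrM gtr0_norm// ltr0_norm; last by lra.
  have : t * (1 / 2) <= t * (- w x2) by rewrite ler_pM2l//; lra.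
  lra.
pose sg := if 0 < w x0 then s else t.
have sg0 : 0 < sg by rewrite /sg; case: ifP.
have sgL : sg <= 2 * L0 by rewrite /sg; case: ifP.
exists (comb s t (pos_part u) (neg_part u)), sg; split.
- by rewrite sg0.
- by move=> x; have := on_nodal_scale_le Mu (ltW s0) (ltW t0); have := cP s t x; lra.
- rewrite (_ : comb 1 (eps * sg) _ v = comb s t (pos_part w) (neg_part w))//.
  apply/funext => x; rewrite [LHS]/comb [RHS]/comb mul1r.
  have [xx0|xx0] := eqVneq x x0; last first.
    by rewrite /pos_part /neg_part wE /v (negbTE xx0) !mulr0 !addr0.
  rewrite xx0 /sg /comb /pos_part /neg_part wE.
  have := ev x0; rewrite /m; have [ux0|ux0] := eqVneq (u x0) 0.
    move=> _; rewrite ux0 !maxxx !minxx !mulr0 !add0r.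
    by have [h|h] := ltP 0 (eps * v x0); ring.
  rewrite lt_min => /andP[_].
  have [u_lt0|u_ge0] := ltP (u x0) 0.
    rewrite (ltr0_norm u_lt0) ltr_norml => /andP[h1 h2].
    rewrite ltNge (_ : u x0 + eps * v x0 <= 0) /=; last by lra.
    rewrite !(max_idPr _) ?(min_idPl _); [ring|lra ..].
  have u_gt0 : 0 < u x0 by rewrite lt_neqAle eq_sym ux0.
  rewrite (gtr0_norm u_gt0) ltr_norml => /andP[h1 h2].
  rewrite (_ : 0 < u x0 + eps * v x0); last by lra.
  rewrite !(max_idPl _) ?(min_idPr _); [ring|lra ..].
Qed.

Lemma ex_nodal_critical : (exists x y : X, x <> y) ->
  exists u, [/\ on_nodal u, forall w, on_nodal w -> En u <= En w
    & forall x0, dEn u (fun x => if x == x0 then 1 else 0) = 0].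
Proof.
move=> /ex_nodal_min[u Mu umin]; exists u; split=> // x0.
have h1 := nodal_min_crit x0 1 Mu umin.
have h2 := nodal_min_crit x0 (-1) Mu umin.
move: h2; rewrite (_ : (fun x => _) = fun x => -1 * (if x == x0 then 1 else 0)).
  by rewrite dEnZ; lra.
by apply/funext => x; case: ifP => _; rewrite ?mulr1 ?mulr0.
Qed.

(** With s projecting |u|, En(s |u|) <= En(s u) <= En u: first by [bform_norm] and evenness of
    [pot], then because u is maximal on its ray. Hence s |u| is itself a minimiser, and criticality
    is proved for it directly. *)
Lemma ex_nehari_critical : inhabited X ->
  exists u, [/\ on_nehari u, forall w, on_nehari w -> En u <= En w,
    forall x, 0 <= u x
    & forall x0, dEn u (fun x => if x == x0 then 1 else 0) = 0].
Proof.
move=> /ex_nehari_min[u Nu umin].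
have [|s s0 Ns] := @project_nehari (fun x => `|u x|).
  by case: Nu => -[x ux] _; exists x; rewrite normr_eq0.
pose z x := s * `|u x|.
have zmin w : on_nehari w -> En z <= En w.
  move=> /umin; apply: le_trans.
  apply: (@le_trans _ _ (En (fun x => s * u x))); last first.
    have := on_nehari_scale_le Nu (ltW s0).
    have : 0 <= a / 4 * (E u u * (s - 1) ^+ 2).
      by rewrite mulr_ge0 ?divr_ge0 ?(ltW a_gt0)// mulr_ge0 ?sqr_ge0 ?bform_ge0.
    lra.
  have hE : E z z <= E (fun x => s * u x) (fun x => s * u x).
    by rewrite !bformZ ler_wpM2l ?sqr_ge0// bform_norm.
  have z0 := bform_ge0 epos z.
  rewrite /En; apply: lerD; last first.
    apply: ler_sum => x _; rewrite le_eqVlt; apply/orP; left; apply/eqP.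
    by rewrite /pot /z !normrM normr_id.
  apply: lerD; first by rewrite ler_wpM2l// divr_ge0// ltW.
  rewrite ler_wpM2l ?divr_ge0//; apply: lerXn2r; rewrite ?nnegrE//.
  exact: le_trans hE.
exists z; split=> //.
  by move=> x; rewrite mulr_ge0// ltW.
move=> x0; have h1 := nehari_min_crit (fun x => if x == x0 then 1 else 0) Ns zmin.
have := nehari_min_crit (fun x => -1 * (if x == x0 then 1 else 0)) Ns zmin.
by rewrite dEnZ; lra.
Qed.

(** Project u+ and u- separately, by factors s and t. The energy is superadditive on s u+ and t u-:
    the potentials add up, the cross term is nonnegative, and squaring is superadditive on
    nonnegative reals. The sum s u+ + t u- lies in the cone on which u is maximal. *)
Lemma nodal_ge_nehari u : on_nodal u -> exists w1 w2,
  [/\ on_nehari w1, on_nehari w2 & En w1 + En w2 <= En u].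
Proof.
move=> Mu; have [[x ux] [y uy] _ _] := Mu.
have [|s s0 Ns] := @project_nehari (pos_part u).
  by exists x; rewrite pos_part_neq0.
have [|t t0 Nt] := @project_nehari (neg_part u).
  by exists y; rewrite neg_part_neq0.
eexists; eexists; split; [exact: Ns|exact: Nt|].
have := on_nodal_scale_le Mu (ltW s0) (ltW t0).
have E1 := bform_ge0 epos (pos_part u); have E2 := bform_ge0 epos (neg_part u).
have E12 := bform_pos_neg_ge0 u.
have : 0 <= a / 4 * (E (pos_part u) (pos_part u) * (s - 1) ^+ 2
           + E (neg_part u) (neg_part u) * (t - 1) ^+ 2).
  by rewrite mulr_ge0 ?divr_ge0 ?(ltW a_gt0)// addr_ge0// mulr_ge0 ?sqr_ge0.
suff : En (fun x => s * pos_part u x) + En (fun x => t * neg_part u x)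
    <= En (comb s t (pos_part u) (neg_part u)) by lra.
rewrite /En !bformZ bform_comb//.
have hp : \sum_x pot p q (A x) (B x) (comb s t (pos_part u) (neg_part u) x)
  = \sum_x pot p q (A x) (B x) (s * pos_part u x)
  + \sum_x pot p q (A x) (B x) (t * neg_part u x).
  rewrite -big_split; apply: eq_bigr => z _ /=; rewrite /comb.
  have /eqP := pos_neg_disj u z; rewrite mulf_eq0 => /orP[] /eqP ->.
    by rewrite mulr0 pot0// !add0r.
  by rewrite mulr0 pot0// !addr0.
rewrite hp.
have F1 : 0 <= s ^+ 2 * E (pos_part u) (pos_part u) by rewrite mulr_ge0 ?sqr_ge0.
have F2 : 0 <= t ^+ 2 * E (neg_part u) (neg_part u) by rewrite mulr_ge0 ?sqr_ge0.
have F12 : 0 <= 2 * s * t * E (pos_part u) (neg_part u).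
  by rewrite !mulr_ge0// ltW.
move: F1 F2 F12; set e1 := s ^+ 2 * _; set e2 := t ^+ 2 * _; set e12 := 2 * s * t * _.
move=> F1 F2 F12.
have h1 : a / 2 * e1 + a / 2 * e2 <= a / 2 * (e1 + e2 + e12).
  by rewrite -mulrDr ler_wpM2l ?divr_ge0 ?(ltW a_gt0)//; lra.
have h2 : b / 4 * e1 ^+ 2 + b / 4 * e2 ^+ 2 <= b / 4 * (e1 + e2 + e12) ^+ 2.
  rewrite -mulrDr ler_wpM2l ?divr_ge0//; nra.
lra.
Qed.

End Energy.

(** * Graphs *)

From mathcomp Require Import finmap.

Lemma finite_ball (R : realType) (G : weighted_graph R) (n : nat) (x : G) :
  finite_set [set y | exists s : seq G,
    [/\ path (@adj R G) x s, last x s = y & (size s <= n)%N]].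
Proof.
elim: n x => [|n IH] x.
  apply: (@sub_finite_set _ _ [set x]); last exact: finite_set1.
  by move=> y [[|z s] [//= _ <- _]].
apply: (@sub_finite_set _ _ ([set x] `|` \bigcup_(z in [set z | adj x z])
  [set y | exists s : seq G,
    [/\ path (@adj R G) z s, last z s = y & (size s <= n)%N]])).
  move=> y [[|z s] [/= ps ls sn]]; first by left.
  by move/andP: ps => [xz ps]; right; exists z => //; exists s.
rewrite finite_setU; split; first exact: finite_set1.
by apply: bigcup_finite => //; exact: adj_locally_finite.
Qed.

(** The slack of 1 extracts an actual path from the infimum. This gives the finiteness of Omega and
    also the paths followed in [gram_pos]. *)
Lemma dist_path (R : realType) (G : weighted_graph R) (x y : G) (D : R) :
  (dist x y <= D%:E)%E -> exists s : seq G,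
    [/\ path (@adj R G) x s, last x s = y & (size s)%:R < D + 1].
Proof.
move=> dD; have /ereal_inf_lt[_ [s [ps ls] <-]] : (dist x y < (D + 1)%:E)%E.
  by apply: le_lt_trans dD _; rewrite lte_fin; lra.
by rewrite lte_fin => sD; exists s.
Qed.

Lemma bounded_domain_finite (R : realType) (G : weighted_graph R)
  (Omega : set G) : bounded_domain Omega -> finite_set Omega.
Proof.
move=> [D DP]; have [[x Ox]|/forallNP O0] := pselect (exists x, Omega x); last first.
  by apply: (sub_finite_set _ (finite_set0 G)) => x /O0.
apply: (sub_finite_set _ (finite_ball (Num.Def.archi_bound `|D + 1|) x)).
move=> y Oy; have [s [ps ls sD]] := dist_path (DP _ _ Ox Oy).
exists s; split=> //; have := archi_boundP (normr_ge0 (D + 1)) => h.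
rewrite -(ler_nat R); have := ler_norm (D + 1); lra.
Qed.

Lemma finite_boundary (R : realType) (G : weighted_graph R)
  (Omega : set G) : finite_set Omega -> finite_set (boundary Omega).
Proof.
move=> fO; apply: (@sub_finite_set _ _ (\bigcup_(x in Omega) [set y | adj x y])).
  by move=> y [_ [x Ox xy]]; exists x.
by apply: bigcup_finite => // x _; exact: adj_locally_finite.
Qed.

Lemma sum_seq_eq (R : realType) (T : eqType) (s : seq T) (f : T -> R) (x : T) :
  uniq s -> \sum_(y <- s) f y * (x == y)%:R = (x \in s)%:R * f x.
Proof.
move=> us; have [xs|xs] := boolP (x \in s).
  rewrite (bigD1_seq x)//= eqxx mulr1 big1_seq ?addr0 ?mul1r// => y /andP[yx _].
  by rewrite eq_sym (negbTE yx) mulr0.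
rewrite mul0r big1_seq// => y /andP[_ ys].
by rewrite (_ : x == y = false) ?mulr0//; apply: contraNF xs => /eqP ->.
Qed.

Lemma even_powE (R : realType) (k m : nat) (t : R) :
  even_pow k m t = `|t| `^ ((2 * k)%:R / m%:R).
Proof.
rewrite /even_pow powRrM powR_mulrn//; congr (_ `^ _).
by rewrite !exprM real_normK ?num_real.
Qed.

(** * The Dirichlet form as a matrix indexed by the vertices of Omega *)

Section Graph.
Variables (R : realType) (G : weighted_graph R) (Omega : set G).
Hypothesis fO : finite_set Omega.
Implicit Types u v w : G -> R.

Local Notation S := (fset_set (Omega `|` boundary Omega)).
Local Notation Nb z := (fset_set [set y : G | adj z y]).
Local Notation X := (fset_set Omega).

Definition dirichlet u v := gint (Omega `|` boundary Omega) (grad_dot u v).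

Let fS : finite_set (Omega `|` boundary Omega).
Proof. by rewrite finite_setU; split=> //; exact: finite_boundary. Qed.

Let memS z : (z \in S) = (z \in Omega `|` boundary Omega).
Proof. by rewrite in_fset_set. Qed.

Let memN z y : (y \in Nb z) = adj z y.
Proof.
rewrite in_fset_set; last exact: adj_locally_finite.
by apply/idP/idP => [/set_mem|h]; [|apply/mem_set].
Qed.

Let memX z : (z \in X) = (z \in Omega).
Proof. by rewrite in_fset_set. Qed.

Lemma dirichletE u v : dirichlet u v = \sum_(z <- S) \sum_(y <- Nb z)
  weight z y / 2 * ((u y - u z) * (v y - v z)).
Proof.
rewrite /dirichlet /gint fsbig_finite//; apply: eq_bigr => z _.
rewrite /grad_dot fsbig_finite; last exact: adj_locally_finite.
rewrite !mulr_sumr; apply: eq_bigr => y _.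
by field; rewrite gt_eqF// mu_gt0.
Qed.

Lemma gintE u : gint Omega u = \sum_(x : X) mu (val x) * u (val x).
Proof. by rewrite /gint fsbig_finite// big_seq_fsetE. Qed.

Lemma dirichletC u v : dirichlet u v = dirichlet v u.
Proof.
rewrite !dirichletE; apply: eq_bigr => z _; apply: eq_bigr => y _.
by rewrite [_ * (v _ - _)]mulrC.
Qed.

Lemma weight_ge0 z y : y \in Nb z -> 0 <= weight z y / 2.
Proof. by rewrite memN => /weight_gt0 h; rewrite divr_ge0// ltW. Qed.

Definition point (x z : G) : R := (x == z)%:R.

Definition ext (v : X -> R) (z : G) : R := \sum_(x : X) v x * point (val x) z.

Lemma ext_val (v : X -> R) (x : X) : ext v (val x) = v x.
Proof.
rewrite /ext (bigD1 x)//= /point eqxx mulr1 big1 ?addr0// => y yx.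
by rewrite (inj_eq val_inj) (negbTE yx) mulr0.
Qed.

Lemma ext_H0 (v : X -> R) : H0 Omega (ext v).
Proof.
move=> z Oz; apply: big1 => x _; rewrite /point; case: eqP => [xz|_]; last by rewrite mulr0.
by exfalso; apply: Oz; rewrite -xz; apply/set_mem; rewrite -memX; exact: valP.
Qed.

Lemma Omega_val z : Omega z -> exists x : X, val x = z.
Proof.
by move=> /mem_set; rewrite -memX => zX; exists (FSetSub zX).
Qed.

Lemma val_Omega (x : X) : Omega (val x).
Proof. by apply/set_mem; rewrite -memX; exact: valP. Qed.

Lemma ext_restr u : H0 Omega u -> ext (fun x => u (val x)) = u.
Proof.
move=> u0; apply/funext => z; have [/Omega_val[x <-]|Oz] := pselect (Omega z).
  exact: ext_val.
by rewrite (u0 _ Oz) (ext_H0 _ Oz).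
Qed.

Definition gram (x y : X) : R := dirichlet (point (val x)) (point (val y)).

Lemma gramC x y : gram x y = gram y x.
Proof. exact: dirichletC. Qed.

(** Indicators of distinct vertices are never both 1 at one point, so in each edge term only the two
    mixed products survive, with a minus sign. *)
Lemma gram_le0 x y : x != y -> gram x y <= 0.
Proof.
move=> xy; rewrite /gram dirichletE.
rewrite big_seq_cond; apply: sumr_le0 => z _.
rewrite big_seq_cond; apply: sumr_le0 => z' /andP[z'N _].
rewrite mulr_ge0_le0 ?weight_ge0//.
have disj t : point (val x) t * point (val y) t = 0.
  rewrite /point -natrM mulnb (_ : _ && _ = false)//.
  by apply/negP => /andP[/eqP <- /eqP /val_inj /eqP]; rewrite eq_sym (negbTE xy).
have p0 x' t : 0 <= point x' t :> R by rewrite /point ler0n.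
rewrite (_ : _ * _ = - (point (val x) z' * point (val y) z)
  - point (val x) z * point (val y) z' + point (val x) z' * point (val y) z'
  + point (val x) z * point (val y) z); last by ring.
by rewrite !disj !addr0 -opprD oppr_le0 addr_ge0// mulr_ge0.
Qed.

Lemma dirichlet_ext (u v : X -> R) :
  dirichlet (ext u) (ext v) = bform gram u v.
Proof.
have dE (w : X -> R) y z : ext w y - ext w z
    = \sum_(x : X) w x * (point (val x) y - point (val x) z).
  rewrite /ext -sumrB; apply: eq_bigr => x _; by rewrite mulrBr.
rewrite dirichletE /bform.
under eq_bigr => z _.
  under eq_bigr => y _.
    rewrite !dE big_distrlr/= mulr_sumr.
    under eq_bigr => i _ do rewrite mulr_sumr.
    over.
  rewrite exchange_big/=.
  under eq_bigr => i _ do rewrite exchange_big/=.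
  over.
rewrite exchange_big/=; apply: eq_bigr => i _.
rewrite exchange_big/=; apply: eq_bigr => j _.
rewrite /gram dirichletE !mulr_suml; apply: eq_bigr => z _.
rewrite !mulr_suml; apply: eq_bigr => y _; ring.
Qed.

Lemma dirichlet_restr u v : H0 Omega u -> H0 Omega v ->
  dirichlet u v = bform gram (fun x => u (val x)) (fun x => v (val x)).
Proof. by move=> u0 v0; rewrite -dirichlet_ext !ext_restr. Qed.

Lemma dirichlet_ge0 u : 0 <= dirichlet u u.
Proof.
rewrite dirichletE big_seq_cond; apply: sumr_ge0 => z _.
rewrite big_seq_cond; apply: sumr_ge0 => y /andP[yN _].
by rewrite mulr_ge0 ?weight_ge0// -expr2 sqr_ge0.
Qed.

Lemma dirichlet_eq0 u z y : dirichlet u u = 0 ->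
  (Omega `|` boundary Omega) z -> adj z y -> u y = u z.
Proof.
rewrite dirichletE => /eqP E0 /mem_set; rewrite -memS => zS zy.
have F0 z' : 0 <= \sum_(y <- Nb z') weight z' y / 2 * ((u y - u z') * (u y - u z')).
  rewrite big_seq_cond; apply: sumr_ge0 => y' /andP[yN _].
  by rewrite mulr_ge0 ?weight_ge0// -expr2 sqr_ge0.
move: E0; rewrite psumr_eq0// => /allP /(_ _ zS) /=.
rewrite big_seq_cond psumr_eq0; last first.
  by move=> y' /andP[yN _]; rewrite mulr_ge0 ?weight_ge0// -expr2 sqr_ge0.
have yN : y \in Nb z by rewrite memN.
move=> /allP /(_ _ yN); rewrite yN /= mulf_eq0 => /orP[|].
  by rewrite gt_eqF// divr_gt0// weight_gt0.
by rewrite -expr2 expf_eq0/= subr_eq0 => /eqP.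
Qed.

(* A function of zero Dirichlet energy is constant along paths issuing from
   Omega, and some such path reaches the boundary. *)
Lemma gram_pos : bounded_domain Omega -> boundary Omega !=set0 ->
  forall v : X -> R, (exists x, v x != 0) -> 0 < bform gram v v.
Proof.
move=> [D DP] [z [Oz [x' Ox' x'z]]] v [x vx].
rewrite -dirichlet_ext lt_neqAle dirichlet_ge0 andbT eq_sym; apply/negP => /eqP E0.
have [s [ps ls _]] := dist_path (DP _ _ (val_Omega x) Ox').
(* The path might leave Omega a priori. A nonzero value passes to every neighbour of a vertex of
   Omega, and being nonzero forces that neighbour into Omega. *)
have step t : Omega t -> ext v t != 0 -> forall y, adj t y -> Omega y /\ ext v y != 0.
  move=> Ot vt y ty; have uE := dirichlet_eq0 E0 (or_introl Ot) ty.
  split; last by rewrite uE.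
  by apply: contrapT => Oy; move: vt; rewrite -uE (ext_H0 _ Oy) eqxx.
have [_ vx'] : Omega x' /\ ext v x' != 0.
  rewrite -ls; have : ext v (val x) != 0 by rewrite ext_val.
  move: (val_Omega x) ps; move: (val x) => t; elim: s {ls} t => [|y s IH] t Ot //=.
  move=> /andP[ty ps] vt; have [Oy vy] := step _ Ot vt _ ty; exact: IH.
by have [] := step _ Ox' vx' _ x'z.
Qed.

(** Green's formula against an indicator: the ordered pairs ending at x and those starting at x
    contribute half each, by symmetry of the weights. *)
Lemma dirichlet_point u x : Omega x ->
  dirichlet u (point x) = - (mu x * laplacian u x).
Proof.
move=> Ox; have xS : x \in S by rewrite memS; apply/mem_set; left.
rewrite dirichletE.
have -> : \sum_(z <- S) \sum_(y <- Nb z)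
    weight z y / 2 * ((u y - u z) * (point x y - point x z))
  = \sum_(z <- S) (\sum_(y <- Nb z) weight z y / 2 * (u y - u z) * (x == y)%:R)
  - \sum_(z <- S) (\sum_(y <- Nb z) weight z y / 2 * (u y - u z)) * (x == z)%:R.
  rewrite -sumrB; apply: eq_bigr => z _; rewrite mulr_suml -sumrB.
  by apply: eq_bigr => y _; rewrite /point; ring.
rewrite (sum_seq_eq _ _ (fset_uniq _)) xS mul1r.
under eq_bigr => z _ do rewrite (sum_seq_eq _ _ (fset_uniq _)) memN.
have -> : \sum_(z <- S) (adj z x)%:R * (weight z x / 2 * (u x - u z))
  = \sum_(z <- Nb x) - (weight x z / 2 * (u z - u x)).
  rewrite -(big_rmcond_in (fun z => adj z x))/=; last first.
    by move=> z _ /negbTE ->; rewrite mul0r.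
  rewrite -big_filter (perm_big (Nb x)); last first.
    apply: uniq_perm; rewrite ?filter_uniq ?fset_uniq// => z.
    rewrite mem_filter memN adj_sym; case xz: (adj x z) => //=.
    (* Every neighbour of a vertex of Omega lies in Omega or in its boundary, so the sum over the
       closure misses no edge at x. *)
    rewrite memS; apply/mem_set.
    have [Oz|Oz] := pselect (Omega z); first by left.
    by right; split=> //; exists x.
  rewrite big_seq [RHS]big_seq; apply: eq_bigr => z; rewrite memN => xz.
  have zx : adj z x by rewrite adj_sym.
  by rewrite zx mul1r (weight_sym zx); ring.
rewrite sumrN -opprD; congr (- _); rewrite /laplacian fsbig_finite; last first.
  exact: adj_locally_finite.
rewrite mulrA divff ?mul1r; last by rewrite gt_eqF// mu_gt0.
by rewrite -big_split; apply: eq_bigr => y _ /=; field.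
Qed.

(** * Dictionary between the graph problem and its finite-dimensional model *)

Section Translation.
Variables (a b lambda p r : R) (k m : nat) (g Q : G -> R).
Hypotheses (p_gt4 : 4 < p) (k_gt0 : (0 < k)%N) (m_gt0 : (0 < m)%N).

Local Notation I := (energy Omega a b lambda p r k m g Q).
Local Notation dI := (denergy Omega a b lambda p r k m g Q).
Local Notation q := ((2 * k)%:R / m%:R : R).

Definition coefA (x : X) : R := lambda * g (val x) * mu (val x).
Definition coefB (x : X) : R := r * Q (val x) * mu (val x).

Local Notation J := (En gram a b p q coefA coefB).
Local Notation dJ := (dEn gram a b p q coefA coefB).

Let p_neq0 : p != 0. Proof. by rewrite gt_eqF//; move: p_gt4; lra. Qed.
Let m_neq0 : m%:R != 0 :> R. Proof. by rewrite pnatr_eq0 -lt0n. Qed.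
Let k_neq0 : (2 * k)%:R != 0 :> R. Proof. by rewrite pnatr_eq0 -lt0n muln_gt0. Qed.

Lemma H0norm_sqr u : H0norm Omega u ^+ 2 = dirichlet u u.
Proof. by rewrite sqr_sqrtr// dirichlet_ge0. Qed.

Lemma energyE u : H0 Omega u -> I u = J (fun x => u (val x)).
Proof.
move=> u0; rewrite /energy /En (_ : _ ^+ 4 = (H0norm Omega u ^+ 2) ^+ 2); last first.
  by rewrite -exprM.
rewrite H0norm_sqr dirichlet_restr// -!addrA; congr (_ + (_ + _)).
rewrite !gintE !mulr_sumr -sumrB -big_split; apply: eq_bigr => x _ /=.
rewrite even_powE /pow_log ln_powR /pot /coefA /coefB.
move: (2 * k)%:R m%:R k_neq0 m_neq0 => K M K0 M0.
by field; rewrite p_neq0 K0 M0.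
Qed.

Lemma denergyE u v : H0 Omega u -> H0 Omega v ->
  dI u v = dJ (fun x => u (val x)) (fun x => v (val x)).
Proof.
move=> u0 v0; rewrite /denergy /dEn H0norm_sqr -/(dirichlet u v) !dirichlet_restr//.
rewrite -!addrA; congr (_ + _).
rewrite !gintE !mulr_sumr -sumrB; apply: eq_bigr => x _ /=.
by rewrite /even_pow_pred /pow_log_pred ln_powR /dpot /coefA /coefB; ring.
Qed.

Lemma H0_pos_part u : H0 Omega u -> H0 Omega (pos_part u).
Proof. by move=> u0 x Ox; rewrite /pos_part u0// maxxx. Qed.

Lemma H0_neg_part u : H0 Omega u -> H0 Omega (neg_part u).
Proof. by move=> u0 x Ox; rewrite /neg_part u0// minxx. Qed.

Lemma H0_neq0P u : H0 Omega u -> u <> cst 0 <-> exists x : X, u (val x) != 0.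
Proof.
move=> u0; split=> [u_neq0|[x ux] u_eq0]; last by rewrite u_eq0 eqxx in ux.
apply: contrapT => /forallNP ux; apply: u_neq0; apply/funext => z.
have [/Omega_val[x <-]|/u0//] := pselect (Omega z).
by apply/eqP/negP => /negP; exact: ux.
Qed.

Lemma nehariP u : nehari Omega a b lambda p r k m g Q u <->
  H0 Omega u /\ on_nehari gram a b p q coefA coefB (fun x => u (val x)).
Proof.
split=> [[u0 /(H0_neq0P u0) un du]|[u0 [/(H0_neq0P u0) un du]]].
  by split=> //; split=> //; rewrite -denergyE.
by split=> //; rewrite denergyE.
Qed.

Lemma nodalP u : nodal_nehari Omega a b lambda p r k m g Q u <->
  H0 Omega u /\ on_nodal gram a b p q coefA coefB (fun x => u (val x)).
Proof.
have posE (x : X) : (pos_part u (val x) != 0) = (0 < u (val x)).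
  exact: (pos_part_neq0 (fun x : X => u (val x))).
have negE (x : X) : (neg_part u (val x) != 0) = (u (val x) < 0).
  exact: (neg_part_neq0 (fun x : X => u (val x))).
split=> [[u0]|[u0 [u1 u2 d1 d2]]].
  have up := H0_pos_part u0; have un := H0_neg_part u0.
  move=> /(H0_neq0P up)[x ux] /(H0_neq0P un)[y uy] d1 d2; split=> //; split.
  - by exists x; rewrite -posE.
  - by exists y; rewrite -negE.
  - by rewrite -d1 denergyE.
  - by rewrite -d2 denergyE.
have up := H0_pos_part u0; have un := H0_neg_part u0.
split=> //.
- by apply/(H0_neq0P up); case: u1 => x ux; exists x; rewrite posE.
- by apply/(H0_neq0P un); case: u2 => x ux; exists x; rewrite negE.
- by rewrite denergyE.
- by rewrite denergyE.
Qed.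

(** Testing with the indicator of x gives mu(x) times the equation at x, by [dirichlet_point]. *)
Lemma solution_of_crit (v : X -> R) :
  (forall x0, dJ v (fun x => if x == x0 then 1 else 0) = 0) ->
  solution Omega a b lambda p r k m g Q (ext v).
Proof.
move=> dv; have v0 := ext_H0 v; split=> // x Ox.
have [x0 x0E] := Omega_val Ox.
have pH0 : H0 Omega (point x).
  move=> z Oz; rewrite /point; case: eqP => // xz.
  by exfalso; apply: Oz; rewrite -xz.
have h : dJ (fun y => ext v (val y)) (fun y => point x (val y)) = 0.
  rewrite (_ : (fun y => ext v _) = v); last first.
    by apply/funext => y; rewrite ext_val.
  rewrite -(dv x0); congr (dEn _ _ _ _ _ _ _ _ _); apply/funext => y.
  by rewrite /point -x0E (inj_eq val_inj) eq_sym; case: eqP.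
move: h; rewrite -denergyE// /denergy H0norm_sqr -/(dirichlet _ (point x)) dirichlet_point//.
have gintP f : gint Omega (fun z => f z * point x z) = mu x * f x.
  rewrite gintE (bigD1 x0)//= x0E /point eqxx mulr1 big1 ?addr0// => y yx.
  by rewrite -x0E (inj_eq val_inj) eq_sym (negbTE yx) !mulr0.
rewrite !gintP -/(dirichlet _ _) => h.
have mu0 : mu x != 0 by rewrite gt_eqF// mu_gt0.
apply: (mulfI mu0); apply/eqP; rewrite -subr_eq0 -[X in _ == X]h; apply/eqP; ring.
Qed.

End Translation.

End Graph.

Lemma ereal_inf_min (R : realType) (T : Type) (M : set T) (J : T -> R) u :
  M u -> (forall w, M w -> J u <= J w) -> (J u)%:E = inf_on M J.
Proof.
move=> Mu umin; apply/eqP; rewrite eq_le; apply/andP; split.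
  by apply: le_ereal_inf_tmp => _ [w Mw <-]; rewrite lee_fin umin.
by apply: ereal_inf_lbound; exists u.
Qed.

(** On a single vertex no function vanishing outside Omega changes sign: [M] is empty and its
    infimum is +oo. Hence the two distinct vertices in the first conjunct; the last one, an
    inequality of extended reals, covers this case too. *)
Theorem theorem1p1 (R : realType) (G : weighted_graph R) (Omega : set G)
    (hOmega : bounded_domain Omega)
    (hOmega0 : Omega !=set0) (hbd0 : boundary Omega !=set0)
    (a b p r : R) (ha : 0 < a) (hb : 0 <= b) (hp : 4 < p) (hr : 1 <= r)
    (k m : nat) (hk : (0 < k)%N) (hm : (0 < m)%N)
    (hkm1 : 1 < (2 * k)%:R / m%:R :> R) (hkmp : (2 * k)%:R / m%:R <= p)
    (Q g : G -> R)
    (hQ : forall x, Omega x -> 0 < Q x) (hg : forall x, Omega x -> 0 < g x)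
    (lambda : R) (hlambda : 0 <= lambda) :
  let I := energy Omega a b lambda p r k m g Q in
  let M := nodal_nehari Omega a b lambda p r k m g Q in
  let N := nehari Omega a b lambda p r k m g Q in
  [/\ (exists x y, [/\ Omega x, Omega y & x <> y]) ->
        exists u, [/\ solution Omega a b lambda p r k m g Q u,
          sign_changing u, M u & (I u)%:E = inf_on M I],
      exists u, [/\ solution Omega a b lambda p r k m g Q u,
        constant_sign Omega u, N u & (I u)%:E = inf_on N I] &
      (2%:E * inf_on N I <= inf_on M I)%E].
Proof.
move=> I M N; have fO := bounded_domain_finite hOmega.
pose A := coefA (Omega := Omega) lambda g; pose B := coefB (Omega := Omega) r Q.
have A_ge0 x : 0 <= A x.
  rewrite /A /coefA mulr_ge0 ?(ltW (mu_gt0 _))// mulr_ge0//.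
  exact: ltW (hg _ (val_Omega fO x)).
have B_gt0 x : 0 < B x.
  rewrite /B /coefB !mulr_gt0 ?mu_gt0//; first by lra.
  exact: hQ _ (val_Omega fO x).
have gpos := gram_pos fO hOmega hbd0.
have IE := energyE fO a b lambda r g Q hp hk hm.
have NE := nehariP fO a b lambda p r k m g Q.
have ME := nodalP fO a b lambda p r k m g Q.
have extK (v : fset_set Omega -> R) : (fun x => ext v (val x)) = v.
  by apply/funext => x; rewrite ext_val.
have [ubar [Nu umin u_ge0 ucrit]] :
    exists u, [/\ N u, forall w, N w -> I u <= I w,
      forall x, Omega x -> 0 <= u x & solution Omega a b lambda p r k m g Q u].
  have X0 : inhabited (fset_set Omega).
    by case: hOmega0 => x /(Omega_val fO)[x0 _]; exact: inhabits.
  have [v [Nv vmin v_ge0 vcrit]] := ex_nehari_critical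
    (gramC fO) (gram_le0 fO) gpos ha hb hp hkm1 hkmp A_ge0 B_gt0 X0.
  exists (ext v); split.
  - by apply/NE; rewrite extK; split=> //; exact: ext_H0.
  - move=> w /NE[w0 Nw]; rewrite /I !IE ?extK//; last exact: ext_H0.
    exact: vmin.
  - by move=> x /(Omega_val fO)[x0 <-]; rewrite ext_val.
  - exact: solution_of_crit.
split.
- move=> [x [y [Ox Oy xy]]].
  have [x0 x0E] := Omega_val fO Ox; have [y0 y0E] := Omega_val fO Oy.
  have xy0 : exists x y : fset_set Omega, x <> y.
    by exists x0, y0 => xy0; apply: xy; rewrite -x0E -y0E xy0.
  have [v [Mv vmin vcrit]] := ex_nodal_critical
    (gramC fO) (gram_le0 fO) gpos ha hb hp hkm1 hkmp A_ge0 B_gt0 xy0.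
  have Mu : M (ext v) by apply/ME; rewrite extK; split=> //; exact: ext_H0.
  exists (ext v); split=> //.
  + exact: solution_of_crit.
  + by case: Mu.
  + apply: ereal_inf_min => // w /ME[w0 Mw].
    rewrite /I !IE ?extK//; last exact: ext_H0.
    exact: vmin.
- exists ubar; split=> //; first by left.
  exact: ereal_inf_min.
- rewrite -(ereal_inf_min Nu umin) -EFinM.
  apply: le_ereal_inf_tmp => _ [w /ME[w0 Mw] <-]; rewrite lee_fin.
  have [w1 [w2 [Nw1 Nw2 w12]]] := nodal_ge_nehari
    (gramC fO) (gram_le0 fO) gpos ha hb hp hkm1 hkmp A_ge0 B_gt0 Mw.
  have h1 : I ubar <= I (ext w1).
    by apply/umin/NE; rewrite extK; split=> //; exact: ext_H0.
  have h2 : I ubar <= I (ext w2).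
    by apply/umin/NE; rewrite extK; split=> //; exact: ext_H0.
  move: w12; rewrite -(IE _ w0).
  move: h1 h2; rewrite /I ![energy _ _ _ _ _ _ _ _ _ _ (ext _)]IE ?extK;
    [|exact: ext_H0 ..].
  lra.
Qed.
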